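(* Let $p$ be an odd prime and let $P$ be a finite $p$-group of nilpotency class $2$ and exponent $p$. (i) If $\mathcal{H}$ and $\mathcal{K}$ are fully refined central decompositions of $P$, then $|\mathcal{H}|=|\mathcal{K}|$, the multisets $\{|H| : H\in\mathcal{H}\}$ and $\{|K| : K\in\mathcal{K}\}$ coincide, and the multisets $\{|Z(H)| : H\in\mathcal{H}\}$ and $\{|Z(K)| : K\in\mathcal{K}\}$ coincide. (ii) For every positive integer $N$ there exists a finite $p$-group $P$ of class $2$ and exponent $p$ such that the natural action of $\operatorname{Aut} P$ on the set of fully refined central decompositions of $P$ has exactly $N$ orbits.
   Context: A central decomposition of a group $G$ is a set $\mathcal{H}$ of subgroups of $G$ such that distinct members commute elementwise ($[H,K]=1$ for distinct $H,K\in\mathcal{H}$), $G$ is generated by $\mathcal{H}$, and no proper subset of $\mathcal{H}$ generates $G$. A group is centrally indecomposable if its only central decomposition is $\{G\}$. A central decomposition is fully refined if all its members are centrally indecomposable. $\operatorname{Aut} P$ acts on central decompositions by $\mathcal{H}\alpha=\{H\alpha : H\in\mathcal{H}\}$. *)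

(* Defs.v *)
From mathcomp Require Import all_boot all_fingroup all_solvable.
Set Implicit Arguments. Unset Strict Implicit. Unset Printing Implicit Defensive.
Local Open Scope group_scope.

Section CentralDecomp.
Variable gT : finGroupType.

Definition central_decomp (G : {set gT}) (Hs : {set {set gT}}) : bool :=
  [&& [forall H in Hs, group_set H && (H \subset G)],
      [forall H in Hs, forall K in Hs, (H != K) ==> (K \subset 'C(H))],
      <<\bigcup_(H in Hs) H>> == G &
      [forall Ks : {set {set gT}},
         (Ks \proper Hs) ==> (<<\bigcup_(H in Ks) H>> != G)]].

Definition centrally_indecomposable (G : {set gT}) : bool :=
  [forall Hs : {set {set gT}}, central_decomp G Hs == (Hs == [set G])].

Definition fully_refined (G : {set gT}) (Hs : {set {set gT}}) : bool :=
  central_decomp G Hs && [forall H in Hs, centrally_indecomposable H].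

Definition decomp_act (a : {perm gT}) (Hs : {set {set gT}}) : {set {set gT}} :=
  [set [set a x | x in H] | H : {set gT} in Hs].

Definition fr_orbits (P : {group gT}) : {set {set {set {set gT}}}} :=
  [set [set decomp_act a Hs | a in Aut P] | Hs in [set Hs | fully_refined P Hs]].

End CentralDecomp.

(* Main.v *)
(** Write [b] for the commutator form on [V = P / P^`(1)].  The images in
    [V] of the members of a fully refined central decomposition are the ranges of
    orthogonal idempotents with sum 1 in the ring [A] of adjoint pairs of [b]; these
    idempotents are self-adjoint, and primitive among self-adjoint idempotents.  For
    such an idempotent [e] every self-adjoint element of [e A e] is nilpotent or
    invertible, and as [p] is odd a finite sum of nilpotent ones is never [e].  Hence the elements of [e A e] that factor through idempotents not
    isomorphic to [e] span a proper left ideal, and counting [A e] modulo this ideal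
    shows that the number of members isomorphic to [e] does not depend on the
    decomposition.  An isomorphism between self-adjoint [e] and [f] preserves both
    [#|V e|] and the span of [b (V e) (V e)], which determine the orders of a member
    and of its center.

    For the orbits, take [V = F_p^n (x) F_p^3] with [n = 2 N - 1] and [b] the tensor
    product of the standard dot product and the wedge product of [F_p^3], whose
    self-adjoint operators are scalar.  The fully refined decompositions are then the
    orthogonal frames of [F_p^n] up to scaling, and the frames with [k] vectors of
    nonsquare norm form one orbit for each even [k < n]: the discriminant forces [k]
    to be even, and an automorphism multiplies all norms by a single square class,
    which must be trivial because [n] is odd. *)
From HB Require Import structures.
Require Import Defs.
From mathcomp Require Import all_boot all_fingroup all_solvable.
From mathcomp Require Import all_algebra all_character ring.
Set Implicit Arguments. Unset Strict Implicit. Unset Printing Implicit Defensive.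
Local Open Scope group_scope.

(** * Finite rings with involution *)

Section StarRing.
Import GRing.Theory.
Local Open Scope ring_scope.

(** By finiteness the powers of [x] are eventually periodic. *)
Lemma idempotent_power (R : finNzRingType) (x : R) :
  exists2 k, (0 < k)%N & x ^+ k * x ^+ k = x ^+ k.
Proof.
pose f (i : 'I_#|R|.+1) := x ^+ i.
have /injectivePn[i [j neq_ij eq_ij]] : ~~ injectiveb f.
  by apply/injectiveP => /leq_card; rewrite card_ord ltnn.
wlog lt_ij : i j neq_ij eq_ij / (i < j)%N.
  move=> IH; case: (ltngtP i j) => [|lt_ji|/val_inj/eqP]; first exact: IH.
    by apply: (IH j i); rewrite // eq_sym.
  by rewrite (negPf neq_ij).
pose d := (j - i)%N; have d_gt0 : (0 < d)%N by rewrite subn_gt0.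
have eqd m : (i <= m)%N -> x ^+ m = x ^+ (m + d).
  move=> le_im; rewrite -{1}(subnK le_im) exprD; move: eq_ij; rewrite /f => ->.
  by rewrite -exprD /d addnBA 1?ltnW // addnBAC // addnBAC.
have eqtd t m : (i <= m)%N -> x ^+ m = x ^+ (m + t * d).
  move=> le_im; elim: t => [|t IH]; first by rewrite addn0.
  rewrite IH eqd; last by rewrite (leq_trans le_im) ?leq_addr.
  by rewrite mulSn -addnA (addnC d).
(* This exponent is a multiple of the period [d] and at least the preperiod [i], so doubling it does
   not change the power. *)
exists (i.+1 * d)%N; first by rewrite muln_gt0.
by rewrite -exprD -eqtd // (leq_trans (leqnSn i)) // leq_pmulr.
Qed.

Variables (A : finNzRingType) (star : A -> A).

(** Minimality is tested against self-adjoint idempotents only: these are the ones that split a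
    member into commuting factors. *)
Definition star_primitive (e : A) :=
  [&& e != 0, e * e == e, star e == e &
   [forall g, [&& g * g == g, star g == g, e * g == g & g * e == g] ==>
              (g == 0) || (g == e)]].

(** Isomorphism of the modules [e A] and [f A]; [a] and [b] need not be related by [star]. *)
Definition idem_iso (e f : A) :=
  [exists a, exists b,
    [&& e * a == a, a * f == a, f * b == b, b * e == b, a * b == e &
        b * a == f]].

Lemma idem_isoP e f :
  reflect (exists a b, [/\ e * a = a, a * f = a, f * b = b, b * e = b &
                           a * b = e /\ b * a = f])
          (idem_iso e f).
Proof.
apply: (iffP existsP) => [[a /existsP[b]]|[a [b [H1 H2 H3 H4 [H5 H6]]]]].
  by case/and5P=> /eqP ? /eqP ? /eqP ? /eqP ? /andP[/eqP ? /eqP ?]; exists a, b.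
by exists a; apply/existsP; exists b; rewrite H1 H2 H3 H4 H5 H6 !eqxx.
Qed.

Lemma idem_iso_refl e : e * e = e -> idem_iso e e.
Proof. by move=> ee; apply/idem_isoP; exists e, e; rewrite !ee. Qed.

Lemma idem_iso_sym e f : idem_iso e f -> idem_iso f e.
Proof.
by case/idem_isoP=> a [b [? ? ? ? [? ?]]]; apply/idem_isoP; exists b, a.
Qed.

Lemma idem_iso_trans f e g : idem_iso e f -> idem_iso f g -> idem_iso e g.
Proof.
case/idem_isoP=> a [b [ea af fb be [ab ba]]].
case/idem_isoP=> c [d [fc cg gd df [cd dc]]].
apply/idem_isoP; exists (a * c), (d * b); split.
- by rewrite mulrA ea.
- by rewrite -mulrA cg.
- by rewrite mulrA gd.
- by rewrite -mulrA be.
- split; first by rewrite -mulrA (mulrA c) cd fb.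
  by rewrite -mulrA (mulrA b) ba fc.
Qed.

Hypotheses (starD : {morph star : x y / x + y})
  (starM : forall x y, star (x * y) = star y * star x)
  (starK : involutive star).

Lemma star0 : star 0 = 0.
Proof. by apply: (addrI (star 0)); rewrite -starD !addr0. Qed.

Lemma starN x : star (- x) = - star x.
Proof. by apply: (addrI (star x)); rewrite -starD !subrr star0. Qed.

Lemma star1 : star 1 = 1.
Proof. by have := starM 1 (star 1); rewrite mul1r starK mul1r. Qed.

Lemma starX x n : star (x ^+ n) = star x ^+ n.
Proof. by elim: n => [|n IH]; rewrite ?star1 // exprS starM IH exprSr. Qed.

Lemma starMn x n : star (x *+ n) = star x *+ n.
Proof. by elim: n => [|n IH]; rewrite ?star0 // !mulrS starD IH. Qed.

Lemma star_sum (I : Type) (r : seq I) (P : pred I) (F : I -> A) :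
  star (\sum_(i <- r | P i) F i) = \sum_(i <- r | P i) star (F i).
Proof. exact: (big_morph star starD star0). Qed.

Lemma star_primitiveP e : star_primitive e ->
  [/\ e != 0, e * e = e, star e = e &
      forall g, g * g = g -> star g = g -> e * g = g -> g * e = g ->
      g = 0 \/ g = e].
Proof.
case/and4P=> e0 /eqP ee /eqP se /forallP min_e; split=> // g gg sg eg ge.
have := min_e g; rewrite gg sg eg ge !eqxx /=.
by case/orP=> /eqP; [left | right].
Qed.

Lemma corner_expr (e x : A) k : (0 < k)%N -> e * x = x -> x * e = x ->
  e * x ^+ k = x ^+ k /\ x ^+ k * e = x ^+ k.
Proof.
case: k => // k _ ex xe; split; first by rewrite exprS mulrA ex.
by rewrite exprSr -mulrA xe.
Qed.

(** An idempotent power of [x] is again self-adjoint and lies in the corner of [e], so it is [0] or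
    [e]. *)
Lemma primitive_nilp_or_unit e x : star_primitive e ->
  star x = x -> e * x = x -> x * e = x ->
  exists2 k, (0 < k)%N & x ^+ k = 0 \/ x ^+ k = e.
Proof.
case/star_primitiveP=> _ _ _ min_e sx ex xe.
have [k k_gt0 xk] := idempotent_power x; exists k => //.
have [exk xke] := corner_expr k_gt0 ex xe.
by apply: min_e => //; rewrite starX sx.
Qed.

(** If [star x * x] were not nilpotent, some power would be [e]. Then [x] has a left inverse [a],
    and [x * a] is a nonzero self-adjoint idempotent below [f], hence equals [f]; so [a] and [x]
    make [e] and [f] isomorphic. *)
Lemma norm_nilp e f x : star_primitive e -> star_primitive f ->
  f * x = x -> x * e = x -> ~~ idem_iso e f ->
  exists k, (star x * x) ^+ k = 0.
Proof.
move=> prim_e prim_f fx xe not_iso.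
have [e0 ee se _] := star_primitiveP prim_e.
have [f0 ff sf min_f] := star_primitiveP prim_f.
set s := star x * x.
have ex : e * star x = star x by rewrite -{2}xe starM se.
have xf : star x * f = star x by rewrite -{2}fx starM sf.
have ss : star s = s by rewrite starM starK.
have es : e * s = s by rewrite mulrA ex.
have s_e : s * e = s by rewrite -mulrA xe.
have [[|k] // _ [sk|sk]] := primitive_nilp_or_unit prim_e ss es s_e.
  by exists k.+1.
case/negP: not_iso; pose a := s ^+ k * star x.
have ax : a * x = e by rewrite -mulrA -exprSr.
have ea : e * a = a.
  rewrite /a; case: (k) => [|k']; first by rewrite mul1r.
  by rewrite exprS !mulrA ex.
have sa : star (x * a) = x * a by rewrite !starM starX ss starK mulrA.
have af : a * f = a by rewrite -mulrA xf.
have xaxa : x * a * (x * a) = x * a by rewrite -mulrA (mulrA a) ax ea.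
have fxa : f * (x * a) = x * a by rewrite mulrA fx.
have xaf : x * a * f = x * a by rewrite -mulrA af.
have [xa0|xa_f] := min_f _ xaxa sa fxa xaf.
  by case/eqP: e0; rewrite -ee -ax -mulrA (mulrA x) xa0 mul0r mulr0.
by apply/idem_isoP; exists a, x; split.
Qed.

Lemma nilp_not_unit (e x w : A) k : e != 0 -> x * e = x -> x ^+ k = 0 ->
  x * w != e.
Proof.
move=> e0 xe xk; apply/eqP => xw.
have H j : x ^+ j.+1 * w ^+ j.+1 = e.
  elim: j => [|j IH]; first by rewrite !expr1.
  have xj : x ^+ j.+1 * e = x ^+ j.+1 by rewrite exprSr -mulrA xe.
  by rewrite exprSr (exprS w) -mulrA (mulrA x) xw mulrA xj.
case: k => [|k] in xk; first by case/eqP: (oner_neq0 A); rewrite -xk.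
by case/eqP: e0; rewrite -(H k) xk mul0r.
Qed.

Variable (p : nat).
Hypotheses (pcharA : p \in [pchar A]) (p_odd : odd p).

Lemma expr_pB (x y : A) m : GRing.comm x y ->
  (x - y) ^+ (p ^ m) = x ^+ (p ^ m) - y ^+ (p ^ m).
Proof.
move=> cxy; elim: m => [|m IH]; first by rewrite !expr1.
rewrite expnSr !exprM IH -!(pFrobenius_autE pcharA) pFrobenius_autB_comm //.
exact/commrX/commr_sym/commrX/commr_sym.
Qed.

(* The square root of the unipotent element [e - z] exists because [p] is odd;
   it is used to absorb a nilpotent summand [z] by a congruence. *)
Lemma primitive_sum_unit e (s : seq A) : star_primitive e ->
  (forall z, z \in s -> [/\ star z = z, e * z = z & z * e = z]) ->
  \sum_(z <- s) z = e -> exists2 z, z \in s & exists w, z * w = e.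
Proof.
move=> prim_e; have [e0 ee se _] := star_primitiveP prim_e.
elim: {s}(size s) {-2}s (erefl (size s)) => [|n IH] [|z s] //= => [_|[sz_s]] sP.
  by rewrite big_nil => /esym/eqP; rewrite (negPf e0).
rewrite big_cons => sum_s.
have [sz ez ze] := sP z (mem_head _ _).
have [[|k] // _ [zk|zk]] := primitive_nilp_or_unit prim_e sz ez ze; last first.
  by exists z; [exact: mem_head | exists (z ^+ k); rewrite -exprS].
(* By Frobenius [u ^+ N = e - z ^+ N = e]. Since [N = 2 r + 1], the self-adjoint element
   [w = u ^+ r] satisfies [w * u * w = e]. *)
pose u := e - z; pose N := (p ^ k.+1)%N; pose r := N./2.
have p_gt1 : (1 < p)%N := prime_gt1 (pcharf_prime pcharA).
have Nk : (k.+1 < N)%N by exact: ltn_expl.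
have oddN : odd N by rewrite oddX p_odd orbT.
have N2 : N = (r + 1 + r)%N.
  by rewrite addn1 addSn addnn -[LHS](odd_double_half N) oddN.
have r_gt0 : (0 < r)%N by rewrite lt0n; apply/eqP => r0; rewrite N2 r0 in Nk.
have N_gt0 : (0 < N)%N := leq_trans (ltn0Sn _) Nk.
have eN j : (0 < j)%N -> e ^+ j = e.
  by case: j => // j _; elim: j => // j IHj; rewrite exprS IHj ee.
have uN : u ^+ N = e.
  rewrite /u expr_pB; last by rewrite /GRing.comm ez ze.
  by rewrite -/N eN // -(subnK (ltnW Nk)) exprD zk mulr0 subr0.
have eu : e * u = u by rewrite mulrBr ee ez.
have ue : u * e = u by rewrite mulrBl ee ze.
have su : star u = u by rewrite starD starN se sz.
pose w := u ^+ r.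
have [ew we] := corner_expr r_gt0 eu ue; rewrite -/w in ew we.
have wuw : w * u * w = e by rewrite -uN N2 !exprD expr1.
have uww : u * w * w = e by rewrite -wuw /w -exprS exprSr.
have sw : star w = w by rewrite starX su.
have sum_u : \sum_(y <- s) y = u by rewrite /u -sum_s addrAC subrr add0r.
(* The other summands add up to [u]; after multiplication by [w] on both sides they add up to [e],
   and there is one summand fewer. *)
have [|||y' /mapP[y ys ->] [t yt]] := IH [seq w * y * w | y <- s].
- by rewrite size_map.
- move=> y' /mapP[y ys ->]; have [|sy ey ye] := sP y; first by rewrite inE ys orbT.
  by split; [rewrite !starM sw sy mulrA | rewrite !mulrA ew | rewrite -!mulrA we].
- by rewrite big_map -mulr_suml -mulr_sumr sum_u.
exists y; first by rewrite inE ys orbT.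
have [|sy ey ye] := sP y; first by rewrite inE ys orbT.
exists (w * t * w).
have <- : u * w * (w * y * w * t) * w = y * (w * t * w).
  by rewrite !mulrA uww ey.
by rewrite yt -(mulrA u) we uww.
Qed.

(** * Counting the idempotents isomorphic to a given one *)

Section Count.
Variable e : A.
Hypothesis prim_e : star_primitive e.

(** The second component of [q] is an arbitrary ring element. Indexing by such pairs lets a single
    coefficient function describe every finite sum of products. *)
Let alien (q : A * A) := star_primitive q.1 && ~~ idem_iso e q.1.

(* The left ideal of the corner ring [e A e] spanned by the products of
   elements of [e A f] and [f A e], for [f] not isomorphic to [e]. *)
Definition alien_ideal : {set A} :=
  [set \sum_(q : A * A | alien q) e * (c : {ffun A * A -> A}) q * q.1 * q.2 * e
  | c in {ffun A * A -> A}].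

(** If [e] were in the ideal, it would be a sum of terms [star phi * psi] with [phi] and [psi] in
    [f A e]. Averaging with the adjoint and polarizing turns it into a sum of multiples of norms
    [star x * x], all nilpotent by [norm_nilp], against [primitive_sum_unit]. *)
Lemma alien_ideal_proper : e \notin alien_ideal.
Proof.
have [e0 ee se _] := star_primitiveP prim_e.
apply/imsetP => -[c _ sum_e].
pose phi q := q.1 * star (c q) * e; pose psi q := q.1 * q.2 * e.
pose s x := star x * x.
have p_gt1 : (1 < p)%N := prime_gt1 (pcharf_prime pcharA).
(* Multiplication by [m] is division by 2 in characteristic [p]. *)
pose m := (p.+1)./2.
have m2 : (m + m = p.+1)%N by rewrite addnn -[RHS]odd_double_half /= p_odd.
have mK x : (x + x : A) *+ m = x.
  rewrite mulrnDl -mulrnDr m2 mulrSr -mulr_natl (pcharf0 pcharA) mul0r.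
  by rewrite add0r.
pose t1 := [seq s (phi q + psi q) *+ m | q <- enum alien].
pose t2 := [seq - s (phi q) *+ m | q <- enum alien].
pose t3 := [seq - s (psi q) *+ m | q <- enum alien].
have fphi q : alien q -> q.1 * phi q = phi q /\ phi q * e = phi q.
  case/andP=> /star_primitiveP[_ ff _ _] _.
  by rewrite /phi !mulrA ff -!mulrA ee.
have fpsi q : alien q -> q.1 * psi q = psi q /\ psi q * e = psi q.
  case/andP=> /star_primitiveP[_ ff _ _] _.
  by rewrite /psi !mulrA ff -!mulrA ee.
have fsum q : alien q -> q.1 * (phi q + psi q) = phi q + psi q /\
    (phi q + psi q) * e = phi q + psi q.
  by move=> aq; have [? ?] := fphi q aq; have [? ?] := fpsi q aq;
     split; rewrite ?mulrDr ?mulrDl; congr (_ + _).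
have sP q x : alien q -> q.1 * x = x -> x * e = x ->
    [/\ star (s x) = s x, e * s x = s x, s x * e = s x &
        exists k, (s x) ^+ k = 0].
  case/andP=> prim_q not_iso fx xe.
  have xs : e * star x = star x by rewrite -{2}xe starM se.
  split; first by rewrite starM starK.
  - by rewrite mulrA xs.
  - by rewrite -mulrA xe.
  exact: norm_nilp not_iso.
have polar x y : s (x + y) + (- s x - s y) = star x * y + star y * x.
  apply: (addIr (s x + s y)); rewrite -opprD subrK /s starD mulrDl !mulrDr.
  by rewrite [star x * x + star x * y]addrC addrACA.
have tP z : z \in t1 ++ t2 ++ t3 ->
    exists q x, [/\ alien q, q.1 * x = x, x * e = x &
                    z = s x *+ m \/ z = - s x *+ m].
  rewrite !mem_cat => /or3P[] /mapP[q]; rewrite mem_enum => aq ->.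
  - by have [? ?] := fsum q aq; exists q, (phi q + psi q); split=> //; left.
  - by have [? ?] := fphi q aq; exists q, (phi q); split=> //; right.
  - by have [? ?] := fpsi q aq; exists q, (psi q); split=> //; right.
have [| |z /tP[q [x [aq fx xe zE]]] [w zw]] :=
    primitive_sum_unit (s := t1 ++ t2 ++ t3) prim_e.
- move=> z /tP[q [x [aq fx xe zE]]]; have [ss es s_e _] := sP q x aq fx xe.
  by case: zE => ->; rewrite ?starMn ?starN ss -?mulrnAr -?mulrnAl
    -?mulNrn ?mulrnAr ?mulrnAl ?mulrN ?mulNr ?es ?s_e.
- rewrite !big_cat !big_map !big_enum_cond /= -!big_split /=.
  rewrite -[RHS]mK -{2}se sum_e star_sum -big_split /= -sumrMnl.
  apply: eq_big => q //; rewrite ?andbT // => aq.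
  have [/star_primitiveP[_ ff sf _] _] := andP aq.
  rewrite -!mulrnDl; congr (_ *+ m).
  rewrite polar /phi /psi !starM !starK se sf !mulrA.
  by rewrite -!(mulrA _ q.1 q.1) ff.
have [_ _ _ [k sk]] := sP q x aq fx xe.
have sxe : s x * e = s x by rewrite -mulrA xe.
case: zE => zE; rewrite {z}zE in zw.
  have /eqP := @nilp_not_unit e (s x) (w *+ m) k e0 sxe sk.
  by rewrite mulrnAr -mulrnAl zw.
have /eqP := @nilp_not_unit e (s x) (- w *+ m) k e0 sxe sk.
by rewrite mulrnAr mulrN -mulNr -mulrnAl zw.
Qed.


Let alien_idealD x y :
  x \in alien_ideal -> y \in alien_ideal -> x + y \in alien_ideal.
Proof.
case/imsetP=> c _ -> /imsetP[d _ ->].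
apply/imsetP; exists [ffun q => c q + d q] => //.
rewrite -big_split; apply: eq_bigr => q _.
by rewrite ffunE mulrDr !mulrDl.
Qed.

Let alien_idealMl b x : x \in alien_ideal -> e * b * x \in alien_ideal.
Proof.
case/imsetP=> c _ ->; apply/imsetP; exists [ffun q => b * e * c q] => //.
by rewrite mulr_sumr; apply: eq_bigr => q _; rewrite ffunE !mulrA.
Qed.

Let alien_ideal_corner x : x \in alien_ideal -> e * x = x /\ x * e = x.
Proof.
have [_ ee _ _] := star_primitiveP prim_e.
case/imsetP=> c _ ->; rewrite mulr_sumr mulr_suml.
by split; apply: eq_bigr => q _; rewrite ?mulrA ?ee // -!mulrA ee.
Qed.

Let alien_ideal0 : 0 \in alien_ideal.
Proof.
apply/imsetP; exists [ffun=> 0] => //.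
by rewrite big1 // => q _; rewrite ffunE mulr0 !mul0r.
Qed.

Let Ae := [set a : A | a * e == a].
Let eAe := [set a : A | (e * a == a) && (a * e == a)].
(** The left submodule of [A e] that [e A] multiplies into the ideal; it plays the role of a radical
    of [A e] at the isomorphism class of [e]. *)
Let J := [set a : A | (a * e == a) && [forall b, e * b * a \in alien_ideal]].

Section Family.
Variables (I : finType) (E : I -> A).
Hypotheses (primE : forall i, star_primitive (E i))
  (orthE : forall i j, i != j -> E i * E j = 0) (sumE : \sum_i E i = 1).

(** Peirce decomposition: [a] is determined by its components [E i * a], and these can be prescribed
    independently. *)
Lemma card_orthogonal_family (M : {set A}) : 0 \in M ->
  {in M &, forall a b, a + b \in M} ->
  (forall i, {in M, forall a, E i * a \in M}) ->
  #|M| = (\prod_i #|[set (E i * a)%R | a in M]|)%N.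
Proof.
move=> M0 MD ME; pose g (a : A) := [ffun i => E i * a].
have idE i : E i * E i = E i by have [] := star_primitiveP (primE i).
have g_inj : injective g.
  move=> a b gab; rewrite -[a]mul1r -[b]mul1r -sumE !mulr_suml.
  by apply: eq_bigr => i _; move/ffunP/(_ i): gab; rewrite !ffunE.
rewrite -(card_imset _ g_inj).
pose F i := mem [set E i * a | a in M].
have /eq_card-> : [set g a | a in M] =i family F.
  move=> c; apply/imsetP/familyP => [[a aM ->] i | cF].
    by rewrite ffunE; apply: imset_f.
  exists (\sum_i c i).
    elim/big_ind: _ => // i _.
    by have /imsetP[a aM ->] := cF i; apply: ME.
  apply/ffunP => i; rewrite ffunE mulr_sumr (bigD1 i) //= big1 => [|j neq_ji].
    by rewrite addr0; have /imsetP[a aM ->] := cF i; rewrite mulrA idE.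
  have /imsetP[a aM ->] := cF j.
  by rewrite mulrA orthE ?mul0r // eq_sym.
by rewrite card_family foldrE big_map big_enum.
Qed.

(** Compare [A e] and [J] component by component. If [E i] is isomorphic to [e], left multiplication
    carries the components onto [e A e] and onto the ideal; otherwise both components coincide. The
    equation is multiplied out to avoid quotients. *)
Lemma card_iso_family :
  (#|Ae| * #|alien_ideal| ^ #|[set i | idem_iso e (E i)]| =
   #|J| * #|eAe| ^ #|[set i | idem_iso e (E i)]|)%N.
Proof.
have [e0 ee _ _] := star_primitiveP prim_e.
have idE i : E i * E i = E i by have [] := star_primitiveP (primE i).
have AeE i : {in Ae, forall a, E i * a \in Ae}.
  by move=> a; rewrite !inE => /eqP ae; rewrite -mulrA ae.
have JE i : {in J, forall a, E i * a \in J}.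
  move=> a; rewrite !inE => /andP[/eqP ae /forallP Ja]; rewrite -mulrA ae eqxx.
  by apply/forallP => b; have := Ja (b * E i); rewrite !mulrA.
rewrite (@card_orthogonal_family Ae) => [||a b|//]; first last.
- by rewrite !inE => /eqP ae /eqP be; rewrite mulrDl ae be.
- by rewrite inE mul0r.
rewrite (@card_orthogonal_family J) => [||a b|//]; first last.
- rewrite !inE => /andP[/eqP ae /forallP Ja] /andP[/eqP be /forallP Jb].
  rewrite mulrDl ae be eqxx; apply/forallP => c.
  by rewrite mulrDr alien_idealD.
- by rewrite inE mul0r eqxx; apply/forallP => b; rewrite mulr0.
have prodX k : (k ^ #|[set i | idem_iso e (E i)]| =
                \prod_i (if idem_iso e (E i) then k else 1))%N.
  by rewrite -big_mkcond prod_nat_const cardsE.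
rewrite !prodX -!big_split /=; apply: eq_bigr => i _.
case: ifP => [/idem_isoP[a [b [ea af fb be [ab ba]]]] | not_iso].
  have mulaI : {in [set E i * x | x in Ae] &, injective ( *%R a)}.
    move=> _ _ /imsetP[x _ ->] /imsetP[y _ ->] /(congr1 ( *%R b)).
    by rewrite !(mulrA b) ba !mulrA idE.
  have -> : #|[set E i * x | x in Ae]| = #|eAe|.
    rewrite -(card_in_imset mulaI); apply: eq_card => y.
    apply/imsetP/idP => [[_ /imsetP[x xe ->] ->]|].
      by move: xe; rewrite !inE => /eqP xe; rewrite !mulrA ea -!mulrA xe !eqxx.
    rewrite inE => /andP[/eqP ey /eqP ye].
    exists (b * y); last by rewrite mulrA ab.
    apply/imsetP; exists (b * y); rewrite ?inE -?mulrA ?ye //.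
    by rewrite mulrA fb.
  have mulaIJ : {in [set E i * x | x in J] &, injective ( *%R a)}.
    apply: sub_in2 mulaI => _ /imsetP[x xJ ->]; apply: imset_f.
    by move: xJ; rewrite !inE => /andP[].
  suff -> : #|[set E i * x | x in J]| = #|alien_ideal| by rewrite mulnC.
  rewrite -(card_in_imset mulaIJ); apply: eq_card => y.
  apply/imsetP/idP => [[_ /imsetP[x xJ ->] ->]| yN].
    move: xJ; rewrite inE => /andP[_ /forallP/(_ a)].
    by rewrite ea mulrA af.
  have [ey ye] := alien_ideal_corner yN.
  exists (b * y); last by rewrite mulrA ab.
  apply/imsetP; exists (b * y); last by rewrite mulrA fb.
  rewrite inE -mulrA ye eqxx; apply/forallP => c.
  by rewrite mulrA -(mulrA e); apply: alien_idealMl.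
rewrite !muln1; apply: eq_card => y.
apply/imsetP/imsetP => [[x xe ->]|[x xJ ->]]; last first.
  by exists x => //; move: xJ; rewrite !inE => /andP[].
exists (E i * x); last by rewrite mulrA idE.
move: xe; rewrite !inE => /eqP xe; rewrite -mulrA xe eqxx.
apply/forallP => b; apply/imsetP.
(* The product [e * b * E i * x * e] is a single term of the ideal, because [E i] is not isomorphic
   to [e]. *)
exists [ffun q => if q == (E i, x) then b else 0] => //.
rewrite (bigD1 (E i, x)) ?big1 /= => [|q /andP[_ /negPf q_neq]|].
- by rewrite ffunE eqxx addr0 -!mulrA xe.
- by rewrite ffunE q_neq mulr0 !mul0r.
- by rewrite /alien primE not_iso.
Qed.

End Family.

(** The ratio of the orders of [e A e] and the ideal exceeds 1, and its power with the wanted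
    exponent is the ratio of the orders of [A e] and [J], in which the family does not occur. *)
Lemma card_iso_eq (I I' : finType) (E : I -> A) (F : I' -> A) :
  (forall i, star_primitive (E i)) ->
  (forall i j, i != j -> E i * E j = 0) -> \sum_i E i = 1 ->
  (forall i, star_primitive (F i)) ->
  (forall i j, i != j -> F i * F j = 0) -> \sum_i F i = 1 ->
  #|[set i | idem_iso e (E i)]| = #|[set i | idem_iso e (F i)]|.
Proof.
move=> primE orthE sumE primF orthF sumF.
have := card_iso_family primE orthE sumE; have := card_iso_family primF orthF sumF.
have [_ ee _ _] := star_primitiveP prim_e.
have N_gt0 : (0 < #|alien_ideal|)%N by apply/card_gt0P; exists 0.
have N_lt : (#|alien_ideal| < #|eAe|)%N.
  apply: proper_card; apply/properP; split.
    by apply/subsetP => x /alien_ideal_corner[ex xe]; rewrite inE ex xe !eqxx.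
  by exists e; [rewrite inE ee eqxx | apply: alien_ideal_proper].
have Ae_gt0 : (0 < #|Ae|)%N by apply/card_gt0P; exists 0; rewrite inE mul0r.
move: #|Ae| #|J| #|alien_ideal| #|eAe| Ae_gt0 N_gt0 N_lt => a j q0 q1 a_gt0.
move: #|[set i | idem_iso e (F i)]| #|[set i | idem_iso e (E i)]| => m n.
move=> q0_gt0 q01 eq_n eq_m; move: m n eq_m eq_n => m n.
wlog le_mn : m n / (m <= n)%N => [IH eq_m eq_n|].
  case/orP: (leq_total m n) => [le_mn|le_nm]; first exact: (IH m n).
  exact/esym/(IH n m).
move=> eq_n eq_m; move: eq_n; rewrite -(subnK le_mn) !expnD => eq_n.
have : (a * q0 ^ m * q0 ^ (n - m) == a * q0 ^ m * q1 ^ (n - m))%N.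
  by rewrite -mulnA (mulnC (q0 ^ m)%N) eq_n eq_m -mulnA (mulnC (q1 ^ m)%N).
rewrite eqn_pmul2l ?muln_gt0 ?a_gt0 ?expn_gt0 ?q0_gt0 // => /eqP.
case: (n - m)%N => [|k] eqk; first by rewrite add0n.
by have := ltn_exp2r q0 q1 (ltn0Sn k); rewrite eqk ltnn q01.
Qed.

End Count.
End StarRing.

(** * Central decompositions and their projections *)

Section CentralDecompositions.
Variable gT : finGroupType.
Implicit Types (G : {group gT}) (Hs : {set {set gT}}).

(** Irredundancy need only be tested by removing one member, as every proper subfamily misses some
    [H]. *)
Lemma central_decompP G Hs :
  reflect [/\ {in Hs, forall H : {set gT}, group_set H /\ H \subset G},
              {in Hs &, forall H K : {set gT}, H != K -> K \subset 'C(H)},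
              <<\bigcup_(H in Hs) H>> = G &
              {in Hs, forall H : {set gT}, <<\bigcup_(K in Hs :\ H) K>> != G}]
          (central_decomp G Hs).
Proof.
apply: (iffP and4P) => [[/forall_inP gHs /forall_inP cHs /eqP genG /forallP minG]|
                        [gHs cHs genG minG]].
  split=> //.
  - by move=> H /gHs/andP[].
  - by move=> H K HsH HsK neqHK; have /forall_inP/(_ K HsK)/implyP-> := cHs H HsH.
  - by move=> H HsH; have /implyP := minG (Hs :\ H); apply; apply: properD1.
split.
- by apply/forall_inP => H /gHs[-> ->].
- apply/forall_inP => H HsH; apply/forall_inP => K HsK; apply/implyP.
  exact: cHs.
- exact/eqP.
apply/forallP => Ks; apply/implyP => /properP[/subsetP sKs [H HsH notKsH]].
apply: contra (minG H HsH) => /eqP genK.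
rewrite eqEsubset; apply/andP; split.
  rewrite -genG genS //; apply/bigcupsP => K /setD1P[_ HsK].
  exact: bigcup_max (subxx _).
rewrite -genK genS //; apply/bigcupsP => K KsK; apply: (bigcup_max K) => //.
by rewrite !inE sKs // andbT; apply: contraNneq notKsH => <-.
Qed.

(** If both factors were proper, they would be distinct and form an irredundant central
    decomposition of [G] with two members. *)
Lemma indecomposable_join G (H K : {group gT}) : centrally_indecomposable G ->
  H <*> K = G -> K \subset 'C(H) -> H :=: G \/ K :=: G.
Proof.
move=> indecG defG cHK.
have [-> | neqHG] := eqVneq (gval H) G; [by left | right; apply/eqP].
apply: contraNT neqHG => neqKG; apply: contraT => neqHG.
have neqHK : gval H != gval K.
  by apply: contraNneq neqHG => eqHK; rewrite -defG -eqHK joingE setUid genGid.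
have cd : central_decomp G [set gval H; gval K].
  apply/central_decompP; split.
  - by move=> L /set2P[] ->; rewrite groupP -defG ?joing_subl ?joing_subr.
  - move=> L M /set2P[] -> /set2P[] ->; rewrite ?eqxx // => _.
    by rewrite centsC.
  - by rewrite bigcup_setU !big_set1.
  move=> L /set2P[] ->.
    suff -> : [set gval H; gval K] :\ gval H = [set gval K].
      by rewrite big_set1 genGid.
    by apply/setP => M; rewrite !inE; case: eqP => // ->; rewrite (negPf neqHK).
  suff -> : [set gval H; gval K] :\ gval K = [set gval H].
    by rewrite big_set1 genGid.
  apply/setP => M; rewrite !inE orbC; case: eqP => // ->.
  by rewrite eq_sym (negPf neqHK).
move/forallP/(_ [set gval H; gval K]): indecG; rewrite cd => /eqP/esym/eqP eqHs.
by have := set21 (gval H) (gval K); rewrite eqHs inE (negPf neqHG).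
Qed.

(** A decomposition containing [G] is [{G}] by irredundancy. Nontriviality makes [{G}] itself
    irredundant, the empty family generating the trivial group. *)
Lemma indecomposableP G :
  G :!=: 1 -> (forall Hs, central_decomp G Hs -> gval G \in Hs) ->
  centrally_indecomposable G.
Proof.
move=> ntG indecG; apply/forallP => Hs; apply/eqP; apply/idP/eqP => [cd|->].
  have HsG := indecG Hs cd; apply/eqP; rewrite eq_sym eqEsubset sub1set HsG /=.
  apply/subsetP => H HsH; rewrite inE; apply: contraT => neqHG.
  have /central_decompP[gHs _ genG /(_ H HsH)/eqP[]] := cd.
  apply/eqP; rewrite eqEsubset -{1}genG genS /=.
    rewrite -{1}[gval G]genGid genS //; apply: (bigcup_max (gval G)) => //.
    by rewrite !inE HsG andbT eq_sym.
  by apply/bigcupsP => K /setD1P[_ HsK]; apply: bigcup_max (subxx _).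
apply/central_decompP; split.
- by move=> H /set1P->; rewrite groupP.
- by move=> H K /set1P-> /set1P->; rewrite eqxx.
- by rewrite big_set1 genGid.
by move=> H /set1P->; rewrite setDv big1 ?gen0 1?eq_sym // => K; rewrite inE.
Qed.

End CentralDecompositions.

(** * Groups of class at most two and exponent [p] *)

Section ClassTwo.
Variables (p : nat) (gT : finGroupType) (P : {group gT}).
Hypotheses (p_pr : prime p) (pP : p.-group P).
Hypotheses (expP : {in P, forall x, x ^+ p = 1}) (clP : P^`(1) \subset 'Z(P)).

(** In exponent [p] the abelianization of [H] is already elementary abelian. *)
Lemma Phi_exponent_p (H : {group gT}) : H \subset P -> 'Phi(H) = H^`(1).
Proof.
move=> sHP; have pH := pgroupS sHP pP.
apply/eqP; rewrite eqEsubset; apply/andP; split.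
  apply: (Phi_min pH (der_norm 1 H)).
  apply/abelemP => //; split; first exact: sub_der1_abelian.
  move=> _ /morphimP[x Nx Hx ->].
  by rewrite -morphX // expP ?(subsetP sHP) // morph1.
by rewrite (Phi_joing pH) joing_subl.
Qed.

Lemma der_sub_center (H : {group gT}) : H \subset P -> P^`(1) \subset 'C(H).
Proof. by move=> sHP; rewrite (subset_trans clP) // subIset // (centS sHP) orbT. Qed.

(** A central [z] outside the Frattini subgroup avoids some maximal subgroup [M], and then [H] is
    the central product of [M] and the cyclic group of [z]. *)
Lemma indecomposable_center (H : {group gT}) z :
  H \subset P -> centrally_indecomposable H ->
  z \in 'Z(H) -> z \in H^`(1) \/ H :=: <[z]>.
Proof.
move=> sHP indecH /setIP[Hz cHz].
have [|notz] := boolP (z \in H^`(1)); [by left | right].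
move: notz; rewrite -(Phi_exponent_p sHP) => /bigcapP notz.
have [M maxM notMz] : exists2 M : {group gT}, maximal M H & z \notin M.
  apply/exists_inP; apply: contraT => /exists_inPn notz'; case: notz => M.
  by case/orP => [/eqP-> // | /notz']; rewrite negbK.
have sMH := proper_sub (maxgroupp maxM).
have defH : M <*> <[z]> = H.
  have /maxgroupP[_ /(_ (M <*> <[z]>)%G)] := maxM.
  rewrite properEneq join_subG sMH cycle_subG Hz joing_subl andbT.
  case: eqP => // _ /(_ isT isT) /= eqM; case/negP: notMz.
  by rewrite -cycle_subG -eqM joing_subr.
have [||/esym->//] := indecomposable_join indecH defH.
- by rewrite cycle_subG (subsetP (centS sMH)).
by move=> MH; rewrite MH Hz in notMz.
Qed.

Section Decomposition.
Variable Hs : {set {set gT}}.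
Hypothesis frHs : fully_refined P Hs.

Definition complement_in (H : {set gT}) := <<\bigcup_(K in Hs :\ H) K>>.
Local Notation rest := complement_in.

Lemma fr_group (H : {set gT}) : H \in Hs -> exists2 K : {group gT}, H = K &
  [/\ K \subset P, centrally_indecomposable K, rest K \subset 'C(K),
      K * rest K = P & rest K != P].
Proof.
have /andP[/central_decompP[gHs cHs genP minP] /forall_inP indecHs] := frHs.
move=> HsH; have [gH sHP] := gHs H HsH; exists (group gH) => //=.
have cHrest : rest H \subset 'C(H).
  rewrite gen_subG; apply/bigcupsP => K /setD1P[neqKH HsK].
  by rewrite cHs // eq_sym.
split=> //; [exact: indecHs | | exact: minP].
rewrite -[H]/(gval (group gH)) -[rest _]/(gval (rest H)%G) -cent_joinEr //=.
apply/eqP; rewrite eqEsubset join_subG sHP -{2}genP !gen_subG /=.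
apply/andP; split.
  by apply/bigcupsP => K /setD1P[_ HsK]; have [] := gHs K HsK.
apply/bigcupsP => K HsK; have [->|neqKH] := eqVneq K H; first exact: joing_subl.
apply: subset_trans (joing_subr _ _); apply: sub_gen.
by apply: bigcup_max (subxx _); rewrite !inE neqKH.
Qed.

(** The derived subgroup of [P] is its Frattini subgroup and consists of nongenerators; so if [H]
    were in this span, the other members would generate [P]. *)
Lemma fr_nongen (H : {set gT}) : H \in Hs -> ~~ (H \subset rest H <*> P^`(1)).
Proof.
move=> HsH; have [K -> [sKP _ _ defP]] := fr_group HsH.
apply: contra => sK; apply/eqP.
suff /Phi_nongen : 'Phi(P) <*> rest K = P by rewrite genGid.
rewrite Phi_exponent_p // joingC; apply/eqP.
rewrite eqEsubset; apply/andP; split.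
  by rewrite join_subG der_sub -defP mulG_subr.
by rewrite -{1}defP mul_subG // joing_subl.
Qed.

(* An element of [H] lying in the span of the other members is central in [H];
   were it outside [H^`(1)], it would generate [H]. *)
Lemma fr_meet (H : {set gT}) z : H \in Hs -> z \in H ->
  z \in rest H <*> P^`(1) -> z \in H^`(1).
Proof.
move=> HsH; have := fr_nongen HsH; have [K -> [sKP indecK cK _ _]] := fr_group HsH.
move=> notsK Kz restz.
have Zz : z \in 'Z(K).
  rewrite inE Kz; apply: subsetP restz.
  by rewrite join_subG cK der_sub_center.
case: (indecomposable_center sKP indecK Zz) => // defK.
by move: notsK; rewrite {1}defK cycle_subG restz.
Qed.

Lemma fr_der (H : {set gT}) : H \in Hs -> H :&: P^`(1) = H^`(1).
Proof.
move=> HsH; apply/eqP; rewrite eqEsubset; apply/andP; split.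
  apply/subsetP => z /setIP[Hz P'z]; apply: (fr_meet HsH Hz).
  exact: (subsetP (joing_subr _ _)).
by have [K -> [sKP _ _ _ _]] := fr_group HsH; rewrite subsetI der_sub dergS.
Qed.

(** In a nonabelian member every central element is in the derived subgroup, since otherwise it
    would generate the member. The order of the center thus depends only on the orders of [H] and of
    its derived subgroup. *)
Lemma fr_card_center (H : {set gT}) : H \in Hs ->
  #|'Z(H)| = if #|H^`(1)| == 1%N then #|H| else #|H^`(1)|.
Proof.
move=> HsH; have [K -> [sKP indecK _ _ _]] := fr_group HsH.
rewrite -trivg_card1; case: ifPn => [/eqP/derG1P/center_idP-> // | ntK'].
congr #|pred_of_set _|; apply/eqP; rewrite eqEsubset; apply/andP; split.
  apply/subsetP => z Zz.
  case: (indecomposable_center sKP indecK Zz) => // defK.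
  by case/eqP: ntK'; apply/derG1P; rewrite defK cycle_abelian.
rewrite subsetI der_sub (subset_trans _ (der_sub_center sKP)) //.
exact: dergS.
Qed.

End Decomposition.

(** * The commutator form on the abelianization *)

Section Linearize.
Import GRing.Theory.
Variables (U : zmodType) (pi : gT -> U).
Hypotheses (piM : {in P &, forall x y, pi (x * y) = (pi x + pi y)%R}).
Hypotheses (pi_onto : forall u, exists2 x, x \in P & pi x = u).
Hypotheses (ker_pi : {in P, forall x, (pi x == 0%R) = (x \in P^`(1))}).

Lemma pi1 : pi 1 = 0%R.
Proof. by apply/eqP; rewrite ker_pi ?group1. Qed.

Lemma piV : {in P, forall x, pi x^-1 = (- pi x)%R}.
Proof.
move=> x Px; apply: (addrI (pi x)).
by rewrite -piM ?groupV // mulgV pi1 subrr.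
Qed.

Lemma pi_eq : {in P &, forall x y, pi x = pi y -> x^-1 * y \in P^`(1)}.
Proof.
move=> x y Px Py eqxy.
by rewrite -ker_pi ?groupM ?groupV // piM ?groupV // piV // eqxy addNr.
Qed.

Definition pi_lift u := odflt 1 [pick x in P | pi x == u].

Lemma pi_liftP u : pi_lift u \in P /\ pi (pi_lift u) = u.
Proof.
rewrite /pi_lift; case: pickP => [x /andP[Px /eqP] // | no].
by have [x Px pix] := pi_onto u; have := no x; rewrite /= Px pix eqxx.
Qed.

Definition commutator_form u v := [~ pi_lift u, pi_lift v].
Local Notation b := commutator_form.

Lemma commgM_class2 x y z : x \in P -> y \in P -> z \in P ->
  [~ x * y, z] = [~ x, z] * [~ y, z] /\ [~ x, y * z] = [~ x, y] * [~ x, z].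
Proof.
move=> Px Py Pz.
have Z x' y' z' : x' \in P -> y' \in P -> z' \in P -> [~ x', y', z'] = 1.
  move=> Px' Py' Pz'; have /setIP[_ /centP cP] := subsetP clP _ (mem_commg Px' Py').
  by apply/eqP/commgP/cP.
rewrite commMgR commgMR !Z // !mulg1; split=> //.
have /setIP[P1 /centP c1] := subsetP clP _ (mem_commg Px Pz).
by apply: c1; have /setIP[] := subsetP clP _ (mem_commg Px Py).
Qed.

(** The choice of lifts is immaterial: two lifts differ by an element of the derived subgroup, which
    is central. *)
Lemma commutator_formE x y : x \in P -> y \in P -> b (pi x) (pi y) = [~ x, y].
Proof.
move=> Px Py; rewrite /b.
have [Px' pix'] := pi_liftP (pi x); have [Py' piy'] := pi_liftP (pi y).
move: (pi_lift (pi x)) (pi_lift (pi y)) Px' pix' Py' piy' => x' y' Px' pix' Py' piy'.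
have := pi_eq Px Px' (esym pix'); have := pi_eq Py Py' (esym piy').
set s := y^-1 * y'; set t := x^-1 * x' => P's P't.
have [sP cs] := setIP (subsetP clP _ P's); have [tP ct] := setIP (subsetP clP _ P't).
rewrite -(mulKVg x x') -(mulKVg y y') -/s -/t.
have [-> _] := commgM_class2 Px tP (groupM Py sP).
have [_ ->] := commgM_class2 Px Py sP.
have /eqP -> : [~ x, s] == 1 by apply/commgP/commute_sym/(centP cs).
have /eqP -> : [~ t, y * s] == 1 by apply/commgP/(centP ct); rewrite groupM.
by rewrite !mulg1.
Qed.

Lemma commutator_formDl u v w : b (u + v)%R w = b u w * b v w.
Proof.
have [Px <-] := pi_liftP u; have [Py <-] := pi_liftP v; have [Pz <-] := pi_liftP w.
rewrite -piM // !commutator_formE ?groupM //.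
by have [] := commgM_class2 Px Py Pz.
Qed.

Lemma commutator_formDr u v w : b u (v + w)%R = b u v * b u w.
Proof.
have [Px <-] := pi_liftP u; have [Py <-] := pi_liftP v; have [Pz <-] := pi_liftP w.
rewrite -piM // !commutator_formE ?groupM //.
by have [] := commgM_class2 Px Py Pz.
Qed.

(** * Projections onto the members of a decomposition *)

Section Projections.
Variable Hs : {set {set gT}}.
Hypothesis frHs : fully_refined P Hs.
Local Notation rest := (complement_in Hs).

(** The component of [u] along the image of [H], read off from any splitting of [u]. Splittings
    exist by [fr_split], so the default value is never taken. *)
Definition projection (H : {set gT}) (u : U) : U :=
  pi (odflt 1 [pick h in H | [exists k in rest H, pi h + pi k == u]%R]).

Section Member.
Variable H : {set gT}.
Hypothesis HsH : H \in Hs.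

Lemma fr_subset : H \subset P /\ rest H \subset P.
Proof.
have [K -> [sKP _ cK defP _]] := fr_group frHs HsH; split=> //.
by rewrite -defP mulG_subr.
Qed.
Let sHP : {subset H <= P}. Proof. by apply/subsetP; have [] := fr_subset. Qed.
Let sRP : {subset rest H <= P}.
Proof. by apply/subsetP; have [] := fr_subset. Qed.

Lemma fr_split u :
  exists h k, [/\ h \in H, k \in rest H & u = (pi h + pi k)%R].
Proof.
have [x Px <-] := pi_onto u; have [K defH [_ _ _ defP _]] := fr_group frHs HsH.
move: Px; rewrite -{1}defP => /mulsgP[h k Hh Rk ->].
rewrite -defH in Hh Rk; exists h, k; split=> //.
by rewrite piM ?(sHP Hh) ?(sRP Rk).
Qed.

(** For two splittings of one vector, the quotient of the [H] parts agrees modulo the derived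
    subgroup with an element of the other members. By [fr_meet] it is in the derived subgroup, so
    [pi] does not see it. *)
Lemma projectionE h k : h \in H -> k \in rest H ->
  projection H (pi h + pi k)%R = pi h.
Proof.
move=> Hh Rk; rewrite /projection; case: pickP => /= [h' | no]; last first.
  by have /andP[] := no h; split=> //; apply/exists_inP; exists k.
case/andP=> Hh' /exists_inP[k' Rk' /eqP eq_hk].
have [K defH [sKP _ _ _ _]] := fr_group frHs HsH.
have P'kk : pi (h'^-1 * h) = pi (k' * k^-1).
  rewrite !piM ?groupV ?(sHP Hh) ?(sHP Hh') ?(sRP Rk) ?(sRP Rk') //.
  rewrite !piV ?(sHP Hh') ?(sRP Rk) //.
  by apply: (addrI (pi h')); rewrite addrA subrr add0r addrA eq_hk addrK.
have H1 : h'^-1 * h \in H by rewrite defH groupM ?groupV // -defH.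
have R1 : k' * k^-1 \in rest H by rewrite groupM ?groupV.
have /(pi_eq (sRP R1) (sHP H1)) P'1 := esym P'kk.
have : h'^-1 * h \in H^`(1).
  apply: (fr_meet frHs HsH H1).
  rewrite -(mulKVg (k' * k^-1) (h'^-1 * h)).
  by rewrite groupM ?(subsetP (joing_subl _ _) _ R1) ?(subsetP (joing_subr _ _) _ P'1).
rewrite -(fr_der frHs HsH) => /setIP[_].
rewrite -ker_pi; last exact: sHP.
rewrite piM ?groupV ?(sHP Hh) ?(sHP Hh') // piV ?(sHP Hh') //.
by rewrite addrC subr_eq0 => /eqP.
Qed.

Let H1 : 1 \in H.
Proof. by have [K -> _] := fr_group frHs HsH; apply: group1. Qed.

Lemma projectionD u v :
  projection H (u + v)%R = (projection H u + projection H v)%R.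
Proof.
have [h [k [Hh Rk ->]]] := fr_split u; have [h' [k' [Hh' Rk' ->]]] := fr_split v.
have [K defH [sKP _ _ _ _]] := fr_group frHs HsH.
rewrite addrACA -(piM (sHP Hh) (sHP Hh')) -(piM (sRP Rk) (sRP Rk')).
rewrite !projectionE // ?piM ?(sHP Hh) ?(sHP Hh') //; last exact: groupM.
by rewrite defH groupM // -defH.
Qed.

Lemma projection_id h : h \in H -> projection H (pi h) = pi h.
Proof. by move=> Hh; rewrite -[X in projection H X]addr0 -pi1 projectionE. Qed.

Lemma projection_rest k : k \in rest H -> projection H (pi k) = 0%R.
Proof. by move=> Hh; rewrite -[X in projection H X]add0r -pi1 projectionE. Qed.

Lemma projection_mem u : exists2 h, h \in H & projection H u = pi h.
Proof. by have [h [k [Hh Rk ->]]] := fr_split u; exists h; rewrite ?projectionE. Qed.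

(** Both sides equal the commutator of the two [H] parts, because [H] commutes with the other
    members. *)
Lemma projection_sym u v : b (projection H u) v = b u (projection H v).
Proof.
have [h [k [Hh Rk ->]]] := fr_split u; have [h' [k' [Hh' Rk' ->]]] := fr_split v.
rewrite !projectionE // commutator_formDl commutator_formDr.
rewrite !commutator_formE ?(sHP Hh) ?(sHP Hh') ?(sRP Rk) ?(sRP Rk') //.
have [K defH [_ _ cK _ _]] := fr_group frHs HsH.
have -> : [~ h, k'] = 1.
  by apply/eqP/commgP/commute_sym/(centP (subsetP cK _ _)); rewrite -?defH.
have -> : [~ k, h'] = 1.
  by apply/eqP/commgP/(centP (subsetP cK _ _)); rewrite -?defH.
by rewrite !mulg1.
Qed.

Lemma fr_pi_neq0 : exists2 h, h \in H & pi h != 0%R.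
Proof.
have := fr_nongen frHs HsH.
case/subsetPn=> h Hh noth; exists h; rewrite ?ker_pi ?(sHP Hh) //.
by apply: contra noth; apply: subsetP (joing_subr _ _) h.
Qed.

End Member.

Lemma projection_other (H K : {set gT}) h : H \in Hs -> K \in Hs -> H != K ->
  h \in H -> projection K (pi h) = 0%R.
Proof.
move=> HsH HsK neqHK Hh; apply: projection_rest => //.
by apply: mem_gen; apply/bigcupP; exists H; rewrite ?inE ?neqHK.
Qed.

(** The elements whose image satisfies the identity form a subgroup, and it contains every
    member. *)
Lemma projection_sum u : (\sum_(H in Hs) projection H u)%R = u.
Proof.
have [x Px <-] := pi_onto u.
pose A := [set y in P | (\sum_(H in Hs) projection H (pi y))%R == pi y].
have gA : group_set A.
  apply/group_setP; split=> [|y z].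
    rewrite inE group1 pi1; apply/eqP; rewrite big1 // => H HsH.
    by rewrite -{1}pi1 projection_rest ?group1.
  rewrite !inE => /andP[Py /eqP eqy] /andP[Pz /eqP eqz]; rewrite groupM //=.
  rewrite piM // -{2}eqy -{2}eqz -big_split /=; apply/eqP/eq_bigr => H HsH.
  exact: projectionD.
suff /subsetP/(_ x Px) : P \subset group gA by rewrite inE => /andP[_ /eqP].
have /andP[/central_decompP[_ _ <- _] _] := frHs.
rewrite gen_subG; apply/bigcupsP => H HsH; apply/subsetP => h Hh.
rewrite inE (subsetP (proj1 (fr_subset HsH))) //= (bigD1 H) //= projection_id //.
rewrite big1 ?addr0 // => K /andP[HsK neqKH].
by apply: (projection_other HsH) => //; rewrite eq_sym.
Qed.

End Projections.
End Linearize.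
End ClassTwo.

(** * The ring of adjoint pairs *)

Section AdjointRing.
Import GRing.Theory.
Local Open Scope ring_scope.
Variables (F : finFieldType) (n : nat) (gT : finGroupType).

(** Values stay in a multiplicative group, so that no coordinates on the derived subgroup have to be
    chosen. *)
Record biadditive := Biadditive {
  bform :> 'rV[F]_n.+1 -> 'rV[F]_n.+1 -> gT;
  bformDl : forall u v w, bform (u + v) w = (bform u w * bform v w)%g;
  bformDr : forall u v w, bform u (v + w) = (bform u v * bform u w)%g;
  bformV : forall u v, bform v u = (bform u v)^-1%g }.

Variable b : biadditive.

Lemma bform0l v : b 0 v = 1%g.
Proof. by apply: (mulgI (b 0 v)); rewrite -bformDl addr0 mulg1. Qed.

Lemma bform0r u : b u 0 = 1%g.
Proof. by apply: (mulgI (b u 0)); rewrite -bformDr addr0 mulg1. Qed.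

Lemma bformNl u v : b (- u) v = (b u v)^-1%g.
Proof. by apply: (mulgI (b u v)); rewrite -bformDl subrr bform0l mulgV. Qed.

Lemma bformNr u v : b u (- v) = (b u v)^-1%g.
Proof. by apply: (mulgI (b u v)); rewrite -bformDr subrr bform0r mulgV. Qed.

Local Notation M := 'M[F]_n.+1.

Definition adjoint : pred (M * M^c) :=
  fun x => [forall u, forall v, b (u *m x.1) v == b u (v *m (x.2 : M))].

Lemma adjointP (x : M * M^c) :
  reflect (forall u v, b (u *m x.1) v = b u (v *m (x.2 : M))) (adjoint x).
Proof. by apply: (iffP 'forall_'forall_eqP). Qed.

(* The second component lives in the converse ring because taking adjoints
   reverses products; the involution is then the swap. *)
Fact adjoint_subring : subring_closed adjoint.
Proof.
split=> [|x y /adjointP ax /adjointP ay|x y /adjointP ax /adjointP ay].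
- by apply/adjointP => u v; rewrite !mulmx1.
- apply/adjointP => u v /=; rewrite !mulmxBr bformDl bformDr bformNl bformNr.
  by rewrite ax ay.
apply/adjointP => u v /=.
by rewrite [x.1 * y.1]/(x.1 *m y.1) [x.2 * y.2]/((y.2 : M) *m x.2) !mulmxA ay ax.
Qed.
HB.instance Definition _ := GRing.isSubringClosed.Build _ adjoint adjoint_subring.

Record adjoint_ring := AdjointRing { adj_val :> M * M^c; _ : adjoint adj_val }.

HB.instance Definition _ := [isSub for adj_val].
HB.instance Definition _ := [Finite of adjoint_ring by <:].
HB.instance Definition _ := [SubChoice_isSubNzRing of adjoint_ring by <:].

Fact adjoint_swap (x : adjoint_ring) : adjoint (x.2 : M, x.1 : M^c).
Proof.
case: x => x /= /adjointP ax; apply/adjointP => u v /=.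
by rewrite bformV -ax -bformV.
Qed.
Definition adj_star x := AdjointRing (adjoint_swap x).

Lemma adj_inj (x y : adjoint_ring) : x.1 = y.1 -> x.2 = y.2 -> x = y.
Proof.
case: x y => [[x1 x2] ax] [[y1 y2] ay] /= e1 e2; apply: val_inj => /=.
by rewrite e1 e2.
Qed.

Lemma adj_mul1 (x y : adjoint_ring) : (x * y).1 = x.1 *m y.1.
Proof. by []. Qed.

Lemma adj_mul2 (x y : adjoint_ring) : (x * y).2 = (y.2 : M) *m x.2.
Proof. by []. Qed.

Lemma adj_starD : {morph adj_star : x y / x + y}.
Proof. by move=> x y; apply: adj_inj. Qed.

Lemma adj_starM x y : adj_star (x * y) = adj_star y * adj_star x.
Proof. by apply: adj_inj. Qed.

Lemma adj_starK : involutive adj_star.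
Proof. by move=> x; apply: adj_inj. Qed.

Lemma adj_pchar p : p \in [pchar F] -> p \in [pchar adjoint_ring].
Proof.
have natE k : (k%:R : adjoint_ring).1 = k%:R /\ (k%:R : adjoint_ring).2 = k%:R :> M.
  elim: k => [|k [IH1 IH2]] //.
  by rewrite !mulrS; split; [rewrite -IH1 | rewrite -IH2].
case/andP=> p_pr /eqP p0; rewrite inE p_pr; apply/eqP.
have p0M : p%:R = 0 :> M by rewrite -scaler_nat p0 scale0r.
have [E1 E2] := natE p.
by apply: adj_inj; rewrite ?E1 ?E2 p0M.
Qed.

Definition self_adjoint (f : M) := forall u v, b (u *m f) v = b u (v *m f).

Fact self_adjoint_adjoint f : self_adjoint f -> adjoint (f, f : M^c).
Proof. by move=> sf; apply/adjointP. Qed.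
Definition adj_of f sf := AdjointRing (@self_adjoint_adjoint f sf).

Lemma adj_self (x : adjoint_ring) : adj_star x = x -> x.2 = x.1 :> M.
Proof. by move/(congr1 (fun y : adjoint_ring => y.1)). Qed.

Definition form_span (x : adjoint_ring) : {set gT} :=
  [set b (u *m x.1) (v *m x.1) | u in setT, v in setT].
Definition adj_image (x : adjoint_ring) : {set 'rV[F]_n.+1} :=
  [set u *m x.1 | u in setT].

(** Right multiplication by [c] embeds the image of [x] into that of [y]. Writing [y = d * c] and
    moving [c] across the form expresses a value on the image of [y] as a value on the image of
    [x]. *)
Lemma adj_iso_invariant (e f : adjoint_ring) :
  adj_star e = e -> adj_star f = f -> idem_iso e f ->
  (#|adj_image e| = #|adj_image f|) * (form_span e = form_span f).
Proof.
suff iso_le (x y : adjoint_ring) : adj_star x = x -> adj_star y = y ->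
    idem_iso x y -> (#|adj_image x| <= #|adj_image y|)%N /\
                    (form_span y \subset form_span x).
  move=> se sf iso_ef; have iso_fe := idem_iso_sym iso_ef.
  have [le1 sub1] := iso_le _ _ se sf iso_ef.
  have [le2 sub2] := iso_le _ _ sf se iso_fe.
  by split; apply/eqP; rewrite ?eqn_leq ?eqEsubset ?le1 ?le2 ?sub1 ?sub2.
move=> /adj_self sx /adj_self sy /idem_isoP[c [d [xc cy yd dx [cd dc]]]].
have cd1 : c.1 *m d.1 = x.1 by rewrite -adj_mul1 cd.
have dc1 : d.1 *m c.1 = y.1 by rewrite -adj_mul1 dc.
have cy1 : c.1 *m y.1 = c.1 by rewrite -adj_mul1 cy.
have dx1 : d.1 *m x.1 = d.1 by rewrite -adj_mul1 dx.
have cx2 : (c.2 : M) *m x.1 = c.2 by rewrite -sx -adj_mul2 xc.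
have yc2 : y.1 *m (c.2 : M) = c.2 by rewrite -sy -adj_mul2 cy.
have xc1 : x.1 *m c.1 = c.1 by rewrite -adj_mul1 xc.
have xx1 : x.1 *m x.1 = x.1 by rewrite -{2}cd1 mulmxA xc1 cd1.
split.
  have cI : {in adj_image x &, injective (mulmxr c.1)}.
    move=> _ _ /imsetP[u _ ->] /imsetP[v _ ->] /= /(congr1 (mulmxr d.1)) /=.
    by rewrite -!mulmxA cd1 xx1.
  rewrite -(card_in_imset cI); apply/subset_leq_card/subsetP => _ /imsetP[u _ ->].
  by apply/imsetP; exists (u *m c.1); rewrite ?inE //= -mulmxA cy1.
apply/subsetP => _ /imset2P[u v _ _ ->].
have /adjointP ac := valP c.
rewrite -{1}dc1 mulmxA ac -mulmxA yc2 -dx1 mulmxA -cx2 mulmxA.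
exact: imset2_f.
Qed.

End AdjointRing.

(** * Uniqueness of the orders *)

Lemma count_map_enum (X : finType) (U : eqType) (A : {set X}) (g : X -> U) (t : U) :
  count_mem t [seq g x | x <- enum A] = #|[set x in A | g x == t]|.
Proof.
rewrite count_map -size_filter cardE /enum_mem -filter_predI.
by congr size; apply: eq_filter => x; rewrite /= !inE andbC.
Qed.

Lemma sum_over_set (X : finType) (V : zmodType) (S : {set X}) (G : X -> V) :
  (\sum_(i : {x | x \in S}) G (val i) = \sum_(x in S) G x)%R.
Proof.
rewrite [RHS](reindex_omap (fun i : {x | x \in S} => val i) insub); last first.
  by move=> x Sx; rewrite insubT.
by apply: eq_bigl => i; rewrite (valP i) valK eqxx.
Qed.

Lemma card_over_set (X : finType) (S : {set X}) (Q : pred X) :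
  #|[set i : {x | x \in S} | Q (val i)]| = #|[set x in S | Q x]|.
Proof.
rewrite -(card_imset _ val_inj); apply: eq_card => x; rewrite !inE.
apply/imsetP/andP => [[[y Sy]] | [Sx Qx]]; first by rewrite inE /= => Qy ->.
by exists (Sub x Sx); rewrite ?inE.
Qed.

(** Replacing each element by a chosen representative of its class gives equal multisets when the
    class counts agree; a class invariant is then mapped over them. *)
Lemma perm_eq_classes (X Y T : finType) (U : eqType) (D : pred T) (r : rel T)
    (A : {set X}) (B : {set Y}) (E : X -> T) (F : Y -> T) (inv : T -> U) :
  (forall x, D x -> r x x) -> symmetric r -> transitive r ->
  {in A, forall x, D (E x)} -> {in B, forall y, D (F y)} ->
  (forall x y, D x -> D y -> r x y -> inv x = inv y) ->
  (forall x, D x -> #|[set a in A | r x (E a)]| = #|[set b in B | r x (F b)]|) ->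
  perm_eq [seq inv (E x) | x <- enum A] [seq inv (F y) | y <- enum B].
Proof.
move=> rr rC rT DE DF inv_r eq_count.
pose rep x := odflt x [pick y | D y && r x y].
have repP x : D x -> D (rep x) /\ r x (rep x).
  move=> Dx; rewrite /rep; case: pickP => [y /andP[] // | /(_ x)].
  by rewrite Dx rr.
have rep_eq x y : D x -> D y -> (rep x == rep y) = r x y.
  move=> Dx Dy; have [_ rx] := repP x Dx; have [_ ry] := repP y Dy.
  apply/eqP/idP => [eq_rep | rxy].
    by apply: (rT (rep x)) => //; rewrite eq_rep rC.
  rewrite /rep (eq_pick (Q := fun z => D z && r y z)); last first.
    move=> z /=; congr (_ && _); apply/idP/idP; last exact: rT.
    by apply: rT; rewrite rC.
  by case: pickP => // /(_ y); rewrite Dy rr.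
have permr : perm_eq [seq rep (E x) | x <- enum A] [seq rep (F y) | y <- enum B].
  apply/allP => t; rewrite mem_cat => t_in; apply/eqP.
  rewrite !count_map_enum.
  have [x Dx ->] : exists2 x, D x & t = rep x.
    case/orP: t_in => /mapP[x]; rewrite mem_enum => xin ->.
      by exists (E x); rewrite // DE.
    by exists (F x); rewrite // DF.
  transitivity #|[set a in A | r x (E a)]|; last rewrite eq_count //.
    apply: eq_card => a; rewrite !inE; apply: andb_id2l => /DE Da.
    by rewrite eq_sym rep_eq.
  apply: eq_card => b; rewrite !inE; apply: andb_id2l => /DF Db.
  by rewrite eq_sym rep_eq.
have map_rep (Z : finType) (C : {set Z}) G : {in C, forall z, D (G z)} ->
    [seq inv (G z) | z <- enum C] = [seq inv x | x <- [seq rep (G z) | z <- enum C]].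
  move=> DG; rewrite -map_comp; apply/eq_in_map => z; rewrite mem_enum => /DG Dz /=.
  by have [D1 r1] := repP _ Dz; apply: inv_r.
by rewrite (map_rep _ A E) // (map_rep _ B F) //; apply: perm_map.
Qed.

Section AdditiveMatrix.
Import GRing.Theory.
Local Open Scope ring_scope.

(** Scalars of a prime field are multiples of 1, so additive maps are linear. *)
Lemma additive_mulmx p m n (f : 'rV['F_p]_m -> 'rV['F_p]_n) :
  {morph f : u v / u + v} ->
  forall u, f u = u *m \matrix_(i < m) f (delta_mx 0 i).
Proof.
move=> fD u; have f0 : f 0 = 0 by apply: (addrI (f 0)); rewrite -fD !addr0.
have fZ (c : 'F_p) v : f (c *: v) = c *: f v.
  rewrite -[c]natr_Zp !scaler_nat; elim: (c : nat) => [|k IH]; first by rewrite !mulr0n.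
  by rewrite !mulrS fD IH.
rewrite {1}[u]row_sum_delta (big_morph f fD f0) mulmx_sum_row.
by apply: eq_bigr => i _; rewrite fZ rowK.
Qed.

End AdditiveMatrix.

Section Uniqueness.
Import GRing.Theory.
Variables (p : nat) (gT : finGroupType) (P : {group gT}).
Hypotheses (p_pr : prime p) (p_odd : odd p) (pP : p.-group P).
Hypotheses (expP : {in P, forall x, x ^+ p = 1}) (clP : P^`(1) \subset 'Z(P)).
Variables (n : nat) (pi : gT -> 'rV['F_p]_n.+1).
Hypotheses (piM : {in P &, forall x y, pi (x * y) = (pi x + pi y)%R}).
Hypotheses (pi_onto : forall u, exists2 x, x \in P & pi x = u).
Hypotheses (ker_pi : {in P, forall x, (pi x == 0%R) = (x \in P^`(1))}).

Let bV u v : commutator_form P pi v u = (commutator_form P pi u v)^-1.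
Proof. by rewrite /commutator_form invg_comm. Qed.

Let b := Biadditive (commutator_formDl clP piM pi_onto ker_pi)
  (commutator_formDr clP piM pi_onto ker_pi) bV.
Local Notation A := (adjoint_ring b).

Section Family.
Variable Hs : {set {set gT}}.
Hypothesis frHs : fully_refined P Hs.

Definition projection_mx (H : {set gT}) : 'M['F_p]_n.+1 :=
  \matrix_i projection pi Hs H (delta_mx 0%R i).

Let projE H u : H \in Hs -> (u *m projection_mx H)%R = projection pi Hs H u.
Proof.
move=> HsH; rewrite -additive_mulmx // => v w.
exact: (projectionD p_pr pP expP clP piM pi_onto ker_pi frHs).
Qed.

Fact projection_mx_self H : H \in Hs -> self_adjoint b (projection_mx H).
Proof.
move=> HsH u v; rewrite !projE //.
exact: (projection_sym p_pr pP expP clP piM pi_onto ker_pi frHs).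
Qed.

(** Total in [H], so that it can be summed and mapped over sets; the match on [idP] supplies the
    membership proof that self-adjointness requires. *)
Definition projection_adj (H : {set gT}) : A :=
  if @idP (H \in Hs) is ReflectT HsH then adj_of (projection_mx_self HsH) else 0%R.

Let adjE H : H \in Hs ->
  (projection_adj H).1 = projection_mx H /\ (projection_adj H).2 = projection_mx H.
Proof. by rewrite /projection_adj; case: {-}_ / idP. Qed.

Lemma projection_mx_mul H K : H \in Hs -> K \in Hs ->
  (projection_mx H *m projection_mx K)%R = if H == K then projection_mx H else 0%R.
Proof.
move=> HsH HsK; apply/row_matrixP => i; rewrite !rowE mulmxA !projE //.
have [h Hh ph] := projection_mem p_pr pP expP clP piM pi_onto ker_pi frHs HsH
  (delta_mx 0%R i).
rewrite ph; have [<-|neqHK] := eqVneq H K.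
  rewrite (projE _ HsH) ph.
  exact: (projection_id p_pr pP expP clP piM ker_pi frHs HsH).
by rewrite (projection_other p_pr pP expP clP piM ker_pi frHs HsH HsK) ?mulmx0.
Qed.

Lemma projection_adj_orthogonal H K : H \in Hs -> K \in Hs -> H != K ->
  (projection_adj H * projection_adj K = 0 :> A)%R.
Proof.
move=> HsH HsK neqHK; have [H1 H2] := adjE HsH; have [K1 K2] := adjE HsK.
apply: adj_inj; rewrite ?adj_mul1 ?adj_mul2 ?H1 ?H2 ?K1 ?K2 projection_mx_mul //.
  by rewrite (negPf neqHK).
by rewrite eq_sym (negPf neqHK).
Qed.

Lemma projection_adj_sum : (\sum_(H in Hs) projection_adj H = 1 :> A)%R.
Proof.
have sum_mx : (\sum_(H in Hs) projection_mx H = 1%:M)%R.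
  apply/row_matrixP => i; rewrite !rowE mulmx1 mulmx_sumr.
  rewrite -[RHS](projection_sum p_pr pP expP clP piM pi_onto ker_pi frHs).
  by apply: eq_bigr => H HsH; rewrite projE.
have fst_sum (S : {set {set gT}}) (G : {set gT} -> A) :
    ((\sum_(H in S) G H)%R : A).1 = (\sum_(H in S) (G H).1)%R.
  by apply: (big_morph (fun x : A => x.1)).
have snd_sum (S : {set {set gT}}) (G : {set gT} -> A) :
    ((\sum_(H in S) G H)%R : A).2 = (\sum_(H in S) (G H).2)%R.
  by apply: (big_morph (fun x : A => x.2)).
apply: adj_inj; rewrite ?fst_sum ?snd_sum -[RHS]sum_mx; apply: eq_bigr => H HsH.
  by have [-> _] := adjE HsH.
by have [_ ->] := adjE HsH.
Qed.

(** A self-adjoint idempotent [f] below the projection splits the member into the parts over the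
    image and over the kernel of [f]. These commute because [f] is self-adjoint, so by
    indecomposability one of them is the whole member. *)
Lemma projection_adj_primitive H : H \in Hs ->
  star_primitive (@adj_star _ _ _ b) (projection_adj H).
Proof.
move=> HsH; have [H1 H2] := adjE HsH.
have [K defH [sKP indecK _ _ _]] := fr_group frHs HsH.
apply/and4P; split.
- apply/eqP => E0; have [h Hh] := fr_pi_neq0 p_pr pP expP ker_pi frHs HsH.
  rewrite -(projection_id p_pr pP expP clP piM ker_pi frHs HsH Hh) -projE // -H1 E0.
  by rewrite mulmx0 eqxx.
- apply/eqP/adj_inj; rewrite ?adj_mul1 ?adj_mul2 ?H1 ?H2;
    by rewrite projection_mx_mul // eqxx.
- by apply/eqP/adj_inj; rewrite /= ?H1 ?H2.
apply/forallP => g; apply/implyP => /and4P[/eqP gg /eqP /adj_self sg /eqP Eg /eqP gE].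
set f := g.1 in sg.
have ff : (f *m f)%R = f by rewrite -adj_mul1 gg.
have Ef : (projection_mx H *m f)%R = f by rewrite -H1 -adj_mul1 Eg.
have fE : (f *m projection_mx H)%R = f by rewrite -H1 -adj_mul1 gE.
have sf u v : b (u *m f)%R v = b u (v *m f)%R.
  by have /adjointP := valP g; rewrite /= sg; apply.
have sHP : {subset K <= P} by apply/subsetP.
have mulf x y : x \in K -> y \in K ->
    (pi (x * y) *m f = pi x *m f + pi y *m f)%R.
  by move=> Kx Ky; rewrite piM ?sHP // mulmxDl.
pose A1 := [set x in K | (pi x *m f == pi x)%R].
pose B1 := [set x in K | (pi x *m f == 0)%R].
have pi1 : pi 1 = 0%R by apply: pi1 ker_pi.
have gA1 : group_set A1.
  apply/group_setP; split=> [|x y]; first by rewrite inE group1 pi1 mul0mx eqxx.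
  rewrite !inE => /andP[Kx /eqP fx] /andP[Ky /eqP fy].
  by rewrite groupM //= mulf // fx fy piM ?sHP.
have gB1 : group_set B1.
  apply/group_setP; split=> [|x y]; first by rewrite inE group1 pi1 mul0mx eqxx.
  rewrite !inE => /andP[Kx /eqP fx] /andP[Ky /eqP fy].
  by rewrite groupM //= mulf // fx fy addr0.
have sA1 : A1 \subset K by apply/subsetP => x; rewrite inE => /andP[].
have sB1 : B1 \subset K by apply/subsetP => x; rewrite inE => /andP[].
have imK u : exists2 h, h \in K & (u *m projection_mx H = pi h)%R.
  rewrite projE //.
  have [h Hh ->] := projection_mem p_pr pP expP clP piM pi_onto ker_pi frHs HsH u.
  by exists h; rewrite // -defH.
(* Since [f] maps into the image of [K], the vector [pi x *m f] lifts to some [h] in [K]; then [h]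
   is in [A1] and [h^-1 * x] in [B1]. *)
have defK : group gA1 <*> group gB1 = K.
  apply/eqP; rewrite eqEsubset join_subG sA1 sB1 /=; apply/subsetP => x Kx.
  have [h Kh fh] := imK (pi x *m f)%R; rewrite -mulmxA fE in fh.
  have A1h : h \in A1 by rewrite inE Kh -fh -mulmxA ff eqxx.
  rewrite -(mulKVg h x) groupM //; first exact: (subsetP (joing_subl _ _)).
  apply: (subsetP (joing_subr _ _)); rewrite inE groupM ?groupV //=.
  rewrite mulf ?groupV // (piV piM ker_pi) ?sHP // mulNmx -fh -mulmxA ff.
  by rewrite addNr.
have cAB : group gB1 \subset 'C(group gA1).
  apply/centsP => y; rewrite inE => /andP[Ky /eqP fy] x.
  rewrite inE => /andP[Kx /eqP fx]; apply/esym/commgP.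
  rewrite -(commutator_formE clP piM pi_onto ker_pi) ?sHP // -fx.
  by rewrite -[commutator_form P pi]/(bform b) sf fy bform0r.
have [/= defA|/= defB] := indecomposable_join indecK defK cAB.
  apply/orP; right; apply/eqP.
  have Ef' : projection_mx H = f.
    rewrite -Ef; apply/row_matrixP => i; rewrite !rowE mulmxA.
    have [h Kh ->] := imK (delta_mx 0%R i).
    by move: Kh; rewrite -defA inE => /andP[_ /eqP].
  by apply: adj_inj; rewrite ?H1 ?H2 ?sg.
apply/orP; left; apply/eqP.
have f0 : f = 0%R.
  rewrite -Ef; apply/row_matrixP => i; rewrite !rowE mulmxA mulmx0.
  have [h Kh ->] := imK (delta_mx 0%R i).
  by move: Kh; rewrite -defB inE => /andP[_ /eqP].
by apply: adj_inj; rewrite ?sg -/f f0.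
Qed.

(** On [H] the map [pi] has the derived subgroup of [H] as kernel, by [fr_der], and the values of
    the form are the commutators of [H]. *)
Lemma card_projection_image H : H \in Hs ->
  (#|H| = #|adj_image (projection_adj H)| * #|H^`(1)|)%N
  /\ <<form_span (projection_adj H)>> = H^`(1).
Proof.
move=> HsH; have [H1 H2] := adjE HsH.
have der_H := fr_der p_pr pP expP clP frHs HsH.
have [K defH [sKP _ _ _ _]] := fr_group frHs HsH.
have sHP : {subset K <= P} by apply/subsetP.
have im_pi u : exists2 h, h \in K & (u *m projection_mx H = pi h)%R.
  rewrite projE //.
  have [h Hh ->] := projection_mem p_pr pP expP clP piM pi_onto ker_pi frHs HsH u.
  by exists h; rewrite // -defH.
have pi_im h : h \in K -> (pi h *m projection_mx H = pi h)%R.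
  rewrite -defH => Hh.
  by rewrite projE // (projection_id p_pr pP expP clP piM ker_pi frHs HsH).
split.
  have piMK : {in K &, {morph pi : x y / x * y}}.
    by move=> x y Kx Ky; rewrite piM ?sHP.
  pose f := Morphism piMK.
  have -> : adj_image (projection_adj H) = f @* K.
    rewrite morphimEdom /adj_image H1; apply/setP => u.
    apply/imsetP/imsetP => [[v _ ->]|[h Kh ->]].
      by have [h Kh ->] := im_pi v; exists h.
    by exists (pi h); rewrite ?inE ?pi_im.
  have ker_f : 'ker f = H^`(1).
    rewrite -der_H defH; apply/setP => x; rewrite !inE.
    apply: andb_id2l => Kx; rewrite -ker_pi ?sHP //.
  rewrite card_morphim setIid -ker_f mulnC [in LHS]defH Lagrange //.
  exact: subsetIl.
suff -> : form_span (projection_adj H) = commg_set K K by rewrite defH.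
apply/setP => x; apply/imset2P/imset2P => [[u v _ _ ->]|[y z Ky Kz ->]].
  have [h Kh eh] := im_pi u; have [k Kk ek] := im_pi v.
  exists h k => //; rewrite H1 eh ek.
  exact: (commutator_formE clP piM pi_onto ker_pi (sHP _ Kh) (sHP _ Kk)).
exists (pi y) (pi z) => //; rewrite H1 !pi_im //.
by rewrite -(commutator_formE clP piM pi_onto ker_pi (sHP _ Ky) (sHP _ Kz)).
Qed.

End Family.

Lemma fr_unique_coord Hs Ks : fully_refined P Hs -> fully_refined P Ks ->
  [/\ #|Hs| = #|Ks|,
      perm_eq [seq #|H| | H : {set gT} <- enum Hs]
              [seq #|K| | K : {set gT} <- enum Ks] &
      perm_eq [seq #|'Z(H)| | H : {set gT} <- enum Hs]
              [seq #|'Z(K)| | K : {set gT} <- enum Ks]].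
Proof.
move=> frHs frKs.
(* The orders of a member and of its center, written in terms of isomorphism invariants of its
   idempotent. *)
pose order (x : A) := (#|adj_image x| * #|<<form_span x>>|)%N.
pose corder (x : A) := if #|<<form_span x>>| == 1%N then order x else #|<<form_span x>>|.
pose star := @adj_star _ _ _ b.
have charA : (p \in [pchar A])%R by apply: adj_pchar; apply: pchar_Fp.
have count_eq (x : A) : star_primitive star x ->
    #|[set H in Hs | idem_iso x (projection_adj frHs H)]| =
    #|[set H in Ks | idem_iso x (projection_adj frKs H)]|.
  move=> prim_x.
  have sumL Ls (frLs : fully_refined P Ls) :
      (\sum_(i : {H | H \in Ls}) projection_adj frLs (val i) = 1)%R.
    by rewrite sum_over_set projection_adj_sum.
  have orthL Ls (frLs : fully_refined P Ls) (i j : {H | H \in Ls}) : i != j ->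
      (projection_adj frLs (val i) * projection_adj frLs (val j) = 0)%R.
    by move=> neq_ij; apply: projection_adj_orthogonal (valP i) (valP j) _.
  have primL Ls (frLs : fully_refined P Ls) (i : {H | H \in Ls}) :
      star_primitive star (projection_adj frLs (val i)).
    exact: projection_adj_primitive (valP i).
  have := card_iso_eq (@adj_starD _ _ _ b) (@adj_starM _ _ _ b)
    (@adj_starK _ _ _ b) charA p_odd prim_x (primL _ frHs) (orthL _ frHs)
    (sumL _ frHs) (primL _ frKs) (orthL _ frKs) (sumL _ frKs).
  rewrite (card_over_set Hs (fun H => idem_iso x (projection_adj frHs H))).
  by rewrite (card_over_set Ks (fun H => idem_iso x (projection_adj frKs H))).
have perm_by (U : eqType) (inv : A -> U) :
    (forall x y : A, #|adj_image x| = #|adj_image y| ->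
       form_span x = form_span y -> inv x = inv y) ->
    perm_eq [seq inv (projection_adj frHs H) | H <- enum Hs]
            [seq inv (projection_adj frKs H) | H <- enum Ks].
  move=> inv_eq.
  apply: (@perm_eq_classes _ _ A U (star_primitive star) (@idem_iso A) Hs Ks
    (projection_adj frHs) (projection_adj frKs) inv).
  - by move=> x /star_primitiveP[_ xx _ _]; apply: idem_iso_refl.
  - by move=> x y; apply/idP/idP; apply: idem_iso_sym.
  - by move=> x y z; apply: idem_iso_trans.
  - by move=> H HsH; apply: projection_adj_primitive.
  - by move=> H KsH; apply: projection_adj_primitive.
  - move=> x y /star_primitiveP[_ _ sx _] /star_primitiveP[_ _ sy _] iso_xy.
    by have [? ?] := adj_iso_invariant sx sy iso_xy; apply: inv_eq.
  exact: count_eq.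
have orderE Ls (frLs : fully_refined P Ls) :
    [seq #|H| | H : {set gT} <- enum Ls] =
    [seq order (projection_adj frLs H) | H <- enum Ls].
  apply/eq_in_map => H; rewrite mem_enum => LsH.
  by have [cardH derH] := card_projection_image frLs LsH; rewrite /order derH.
have corderE Ls (frLs : fully_refined P Ls) :
    [seq #|'Z(H)| | H : {set gT} <- enum Ls] =
    [seq corder (projection_adj frLs H) | H <- enum Ls].
  apply/eq_in_map => H; rewrite mem_enum => LsH.
  have [cardH derH] := card_projection_image frLs LsH.
  by rewrite (fr_card_center p_pr pP expP clP frLs LsH) /corder /order derH -cardH.
have perm_order : perm_eq [seq #|H| | H : {set gT} <- enum Hs]
    [seq #|K| | K : {set gT} <- enum Ks].
  rewrite (orderE _ frHs) (orderE _ frKs); apply: (perm_by nat order) => x y.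
  by rewrite /order => -> ->.
split=> //.
  by have := perm_size perm_order; rewrite !size_map -!cardE.
rewrite (corderE _ frHs) (corderE _ frKs); apply: (perm_by nat corder) => x y.
by rewrite /corder /order => -> ->.
Qed.

End Uniqueness.

Lemma fr_unique (p : nat) (gT : finGroupType) (P : {group gT})
    (Hs Ks : {set {set gT}}) :
  prime p -> odd p -> p.-group P -> P :!=: 1 ->
  {in P, forall x, x ^+ p = 1} -> P^`(1) \subset 'Z(P) ->
  fully_refined P Hs -> fully_refined P Ks ->
  [/\ #|Hs| = #|Ks|,
      perm_eq [seq #|H| | H : {set gT} <- enum Hs]
              [seq #|K| | K : {set gT} <- enum Ks] &
      perm_eq [seq #|'Z(H)| | H : {set gT} <- enum Hs]
              [seq #|'Z(K)| | K : {set gT} <- enum Ks]].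
Proof.
move=> p_pr p_odd pP ntP expP clP.
have nDP : P \subset 'N(P^`(1)) := der_norm 1 P.
have abelE : p.-abelem (P / P^`(1)).
  by rewrite -(Phi_exponent_p p_pr pP expP (subxx P)); apply: Phi_quotient_abelem.
have ntE : P / P^`(1) != 1.
  rewrite -subG1 quotient_sub1 //; apply: contra (ntP) => sPP'.
  have := Phi_proper ntP; rewrite (Phi_exponent_p p_pr pP expP (subxx P)).
  by rewrite properE sPP' andbF.
(* Coordinates on the abelianization, which is elementary abelian and, as [P] is nontrivial, of
   positive dimension. *)
pose pi (x : gT) := abelem_rV abelE ntE (coset P^`(1) x).
apply: (fr_unique_coord p_pr p_odd pP expP clP (pi := pi)).
- move=> x y Px Py; rewrite /pi morphM ?(subsetP nDP) //.
  by rewrite abelem_rV_M // mem_quotient.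
- move=> u; have /imsetP[y] : u \in abelem_rV abelE ntE @* (P / P^`(1)).
    exact: mem_im_abelem_rV.
  by rewrite setIid => /morphimP[x Nx Px ->] ->; exists x.
move=> x Px; have Nx := subsetP nDP x Px.
have Ex : coset P^`(1) x \in P / P^`(1) by exact: mem_quotient.
rewrite -(abelem_rV_1 abelE ntE) (inj_in_eq (@abelem_rV_inj _ _ _ abelE ntE)) ?group1 //.
by apply/eqP/idP => [/(coset_idr Nx) | /coset_id].
Qed.

(** * Squares and wedge products *)

Section Squares.
Import GRing.Theory.
Local Open Scope ring_scope.

Definition is_square (F : finFieldType) (x : F) := [exists y, x == y ^+ 2].

Lemma is_squareP (F : finFieldType) (x : F) :
  reflect (exists y, x = y ^+ 2) (is_square x).
Proof. by apply: (iffP existsP) => -[y xy]; exists y; apply/eqP. Qed.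

Lemma is_squareM (F : finFieldType) (x y : F) :
  is_square x -> is_square y -> is_square (x * y).
Proof.
move=> /is_squareP[a ->] /is_squareP[b ->]; apply/is_squareP.
by exists (a * b); rewrite exprMn.
Qed.

Lemma is_squareV (F : finFieldType) (x : F) : is_square x -> is_square x^-1.
Proof. by case/is_squareP=> a ->; apply/is_squareP; exists a^-1; rewrite exprVn. Qed.

(** The unit group is cyclic, and a nonsquare is an odd power of a generator. *)
Lemma nonsquareM (F : finFieldType) (x y : F) :
  ~~ is_square x -> ~~ is_square y -> is_square (x * y).
Proof.
have [g defU] : exists g : {unit F}, [set: {unit F}] = <[g]>%g.
  by apply/cyclicP; apply: field_unit_group_cyclic.
have powP z : ~~ is_square z -> exists k, z = val g ^+ (k.*2.+1).
  move=> nsq; have z0 : z != 0.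
    by apply: contraNneq nsq => ->; apply/is_squareP; exists 0; rewrite expr0n.
  have Uz : z \is a GRing.unit by rewrite unitfE.
  have /cycleP[k ek] : FinRing.unit F Uz \in <[g]>%g by rewrite -defU inE.
  have zE : z = val g ^+ k.
    by rewrite -[LHS]/(val (FinRing.unit F Uz)) ek FinRing.val_unitX.
  have := odd_double_half k; case: (odd k) => kE.
    by exists k./2; rewrite zE -{1}kE.
  case/negP: nsq; apply/is_squareP; exists (val g ^+ k./2).
  by rewrite zE -{1}kE -exprM muln2.
move=> /powP[k ->] /powP[l ->]; apply/is_squareP; exists (val g ^+ (k + l).+1).
by rewrite -exprM -exprD; congr (_ ^+ _); rewrite muln2 doubleS doubleD addSn addnS.
Qed.

Lemma two_neq0 (p : nat) : prime p -> odd p -> 2%:R != 0 :> 'F_p.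
Proof.
move=> p_pr p_odd; rewrite -(dvdn_pcharf (pchar_Fp p_pr)) dvdn_prime2 //.
by apply: contraTneq p_odd => ->.
Qed.

(** Otherwise all sums [1 + ... + 1] would be squares, hence all of [F_p]; but squaring identifies
    [1] and [-1], so it is not onto. *)
Lemma nonsquare_sum (p : nat) : prime p -> odd p ->
  exists a b : 'F_p, ~~ is_square (a ^+ 2 + b ^+ 2).
Proof.
move=> p_pr p_odd.
have [x nsq] : exists x : 'F_p, ~~ is_square x.
  apply/existsP; apply: contraT => /existsPn all_sq.
  have sq_surj : [set (y : 'F_p) ^+ 2 | y in 'F_p] = setT.
    apply/setP => z; rewrite inE; apply/imsetP.
    by have /negPn/is_squareP[y ->] := all_sq z; exists y.
  have /imset_injP sq_inj : #|[set (y : 'F_p) ^+ 2 | y in 'F_p]| == #|'F_p|.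
    by rewrite sq_surj cardsT.
  have /eqP : (1 : 'F_p) = -1 by apply: sq_inj; rewrite ?sqrrN.
  by rewrite -subr_eq0 opprK -[1 + 1]/(2%:R) (negPf (two_neq0 p_pr p_odd)).
suff /existsP[a /existsP[b nab]] :
    [exists a : 'F_p, exists b : 'F_p, ~~ is_square (a ^+ 2 + b ^+ 2)].
  by exists a, b.
apply: contraT => /existsPn all_sq; case/negP: nsq.
rewrite -[x]natr_Zp; elim: (x : nat) => [|k /is_squareP[s ks]].
  by apply/is_squareP; exists 0; rewrite expr0n.
rewrite mulrSr ks; have := all_sq s; move/existsPn/(_ 1).
by rewrite negbK expr1n.
Qed.

End Squares.

(** * The wedge product in dimension three *)

Section Wedge.
Import GRing.Theory.
Local Open Scope ring_scope.
Variable F : fieldType.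
Implicit Types u v w : 'rV[F]_3.

Lemma third_ord3 (i j : 'I_3) : exists2 k : 'I_3, k != i & k != j.
Proof.
have /subsetPn[k _] : ~~ ([set: 'I_3] \subset [set i; j]).
  by apply/negP => /subset_leq_card; rewrite cardsT card_ord cards2; case: (i != j).
by rewrite !inE negb_or => /andP[]; exists k.
Qed.

(* The exterior square of [F^3] is realized as the skew matrices. *)
Definition wedge u v : 'M[F]_3 := u^T *m v - v^T *m u.

Lemma wedgeE u v i j : wedge u v i j = u 0 i * v 0 j - v 0 i * u 0 j.
Proof. by rewrite !mxE !big_ord1 !mxE. Qed.

Lemma wedge_sym u v : wedge u v = - wedge v u.
Proof. by rewrite opprB. Qed.

Lemma wedgeDl u v w : wedge (u + v) w = wedge u w + wedge v w.
Proof. by apply/matrixP => i j; rewrite !(mxE, big_ord1) /=; ring. Qed.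

Lemma wedgeZl c u v : wedge (c *: u) v = c *: wedge u v.
Proof. by apply/matrixP => i j; rewrite !(mxE, big_ord1) /=; ring. Qed.

Lemma wedgeZr c u v : wedge u (c *: v) = c *: wedge u v.
Proof. by rewrite wedge_sym wedgeZl -scalerN -wedge_sym. Qed.

Lemma wedge_parallel u v : v != 0 -> wedge u v = 0 -> exists c, u = c *: v.
Proof.
case/rV0Pn=> j vj uv; exists (u 0 j / v 0 j); apply/rowP => i; rewrite mxE.
move/matrixP/(_ i j): uv; rewrite wedgeE mxE => /eqP; rewrite subr_eq0 => /eqP uv.
by apply: (mulIf vj); rewrite uv mulrAC divfK // mulrC.
Qed.

Lemma wedge_trans u v w : v != 0 -> wedge u v = 0 -> wedge v w = 0 -> wedge u w = 0.
Proof.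
by move=> v0 /(wedge_parallel v0)[c ->] vw; rewrite wedgeZl vw scaler0.
Qed.

Lemma wedge_nondegenerate u : (forall j, wedge u (delta_mx 0 j) = 0) -> u = 0.
Proof.
move=> u0; apply/rowP => i; rewrite mxE.
have [j neq_ij _] := third_ord3 i i.
move/matrixP/(_ i j): (u0 j); rewrite wedgeE !mxE !eqxx eq_sym (negPf neq_ij) /=.
by rewrite mulr1 mul0r subr0.
Qed.

(** Adjoint pairs of the wedge product are scalar. Compare entries on basis vectors: for two indices
    there is a third one in dimension three, and it isolates each off-diagonal entry and links the
    diagonal ones. *)
Lemma adjoint_wedge (f g : 'rV[F]_3 -> 'rV[F]_3) :
  (forall u v, wedge (f u) v = wedge u (g v)) ->
  f =1 (fun u => f (delta_mx 0 0) 0 0 *: u) /\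
  f (delta_mx 0 0) 0 0 = g (delta_mx 0 0) 0 0.
Proof.
move=> fg; pose e i : 'rV[F]_3 := delta_mx 0 i.
have entry i j r s : f (e i) 0 r * (s == j)%:R - (r == j)%:R * f (e i) 0 s =
    (r == i)%:R * g (e j) 0 s - g (e j) 0 r * (s == i)%:R.
  by move/matrixP/(_ r s): (fg (e i) (e j)); rewrite !wedgeE !mxE !eqxx.
have off i k : k != i -> f (e i) 0 k = 0.
  move=> neq_ki; have [j neq_ji neq_jk] := third_ord3 i k.
  have := entry i j k j; rewrite eqxx eq_sym (negPf neq_jk) (negPf neq_ki) (negPf neq_ji).
  by rewrite /= mulr1 !mul0r mulr0 !subr0.
have off' i k : k != i -> g (e i) 0 k = 0.
  move=> neq_ki; have [j neq_ji neq_jk] := third_ord3 i k.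
  have := entry j i j k; rewrite eqxx (negPf neq_ki) (negPf neq_ji).
  by rewrite [k == j]eq_sym (negPf neq_jk) /= mul1r !mulr0 !mul0r !subr0.
have diag i j : i != j -> f (e i) 0 i = g (e j) 0 j.
  move=> neq_ij; have := entry i j i j; rewrite !eqxx (negPf neq_ij).
  by rewrite eq_sym (negPf neq_ij) /= mulr1 mul1r mul0r mulr0 !subr0.
set lam := f _ 0 0.
have fii i : f (e i) 0 i = lam.
  have [j neq_ji neq_j0] := third_ord3 i 0.
  by rewrite (diag i j) 1?eq_sym // -(diag 0 j) 1?eq_sym.
have gjj j : g (e j) 0 j = lam.
  by have [i neq_ij _] := third_ord3 j j; rewrite -(diag i j).
have ge j : g (e j) = lam *: e j.
  apply/rowP => k; rewrite !mxE eqxx /=; have [->|neq_kj] := eqVneq k j.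
    by rewrite gjj mulr1.
  by rewrite off' // mulr0.
split; last exact/esym/gjj.
move=> u; apply/eqP; rewrite -subr_eq0; apply/eqP/wedge_nondegenerate => j.
by rewrite wedgeDl fg ge wedgeZr -scaleNr wedgeZl scaleNr subrr.
Qed.

(** The matrices [B] and [mu *: invmx B] are adjoint, so [B] is a scalar [c] and its factor is
    [c ^+ 2]. *)
Lemma wedge_similitude (B : 'M[F]_3) mu : mu != 0 ->
  (forall u v, mu *: wedge u v = wedge (u *m B) (v *m B)) ->
  exists c, mu = c ^+ 2.
Proof.
move=> mu0 simB.
have B_unit : B \in unitmx.
  rewrite -row_free_unit; apply: inj_row_free => u uB.
  apply: wedge_nondegenerate => j; apply: (scalerI mu0).
  by rewrite simB uB scaler0 /wedge trmx0 mul0mx mulmx0 subrr.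
pose f (u : 'rV[F]_3) := u *m B; pose g (v : 'rV[F]_3) := mu *: (v *m invmx B).
have fg u v : wedge (f u) v = wedge u (g v) by rewrite wedgeZr simB mulmxKV.
have [fE _] := adjoint_wedge fg; set c := f _ 0 0 in fE.
exists c; have := simB (delta_mx 0 0) (delta_mx 0 1).
rewrite -![_ *m B]/(f _) !fE wedgeZl wedgeZr scalerA -expr2.
move/matrixP/(_ 0 1); rewrite mxE [RHS]mxE wedgeE !mxE !eqxx /=.
by rewrite mulr1 mul0r subr0 !mulr1.
Qed.

End Wedge.

(** * The dot product tensored with the wedge product *)

Lemma mulmx_sum_col_row (R : pzRingType) m n k (A : 'M[R]_(m, n)) (B : 'M[R]_(n, k)) :
  (A *m B = \sum_i col i A *m row i B)%R.
Proof.
apply/matrixP => i j; rewrite mxE summxE; apply: eq_bigr => l _.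
by rewrite !mxE big_ord1 !mxE.
Qed.

Section Heisenberg.
Import GRing.Theory.
Local Open Scope ring_scope.
Variables (p n : nat).
Local Notation F := 'F_p.

(** An [n] by 3 matrix is a tensor in [F^n (x) F^3]; on pure tensors this is the dot product times
    the wedge product, see [line_coef]. *)
Definition heis_form (X Y : 'M[F]_(n, 3)) : 'M[F]_3 := X^T *m Y - Y^T *m X.
Local Notation b := heis_form.

Lemma heis_formDl X Y Z : b (X + Y) Z = b X Z + b Y Z.
Proof.
by rewrite /heis_form linearD /= mulmxDl mulmxDr opprD addrACA.
Qed.

Lemma heis_form_sym X Y : b Y X = - b X Y.
Proof. by rewrite opprB. Qed.

Lemma heis_formDr X Y Z : b X (Y + Z) = b X Y + b X Z.
Proof. by rewrite heis_form_sym heis_formDl opprD -!heis_form_sym. Qed.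

Lemma heis_formNl X Y : b (- X) Y = - b X Y.
Proof. by rewrite /heis_form linearN /= mulNmx mulmxN opprD. Qed.

Lemma heis_formXX X : b X X = 0.
Proof. exact: subrr. Qed.

Lemma heis_form0l X : b 0 X = 0.
Proof. by rewrite /heis_form trmx0 mul0mx mulmx0 subrr. Qed.

Lemma heis_form0r X : b X 0 = 0.
Proof. by rewrite heis_form_sym heis_form0l oppr0. Qed.

Lemma heis_formXMn X k : b X (X *+ k) = 0.
Proof.
elim: k => [|k IH]; first by rewrite mulr0n heis_form0r.
by rewrite mulrS heis_formDr IH heis_formXX addr0.
Qed.

Lemma heis_form_tr X Y : (b X Y)^T = - b X Y.
Proof. by rewrite /heis_form linearB /= !trmx_mul !trmxK opprB. Qed.

Lemma heis_form_col (Z : 'M[F]_(n, 3)) (y : 'cV[F]_n) (v : 'rV[F]_3) :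
  b Z (y *m v) = wedge (y^T *m Z) v.
Proof. by rewrite /heis_form /wedge !trmx_mul trmxK !mulmxA. Qed.

(* An alias of the product type, which already carries the direct product group
   law. *)
Definition heis : predArgType := ('M[F]_(n, 3) * 'M[F]_3)%type.
HB.instance Definition _ := Finite.on heis.

(** The central extension with cocycle [b]. As [b] is alternating, powers and inverses are taken
    coordinatewise, and commutators are given by [2 b]. *)
Definition heis_mul (x y : heis) : heis := (x.1 + y.1, x.2 + y.2 + b x.1 y.1).
Definition heis_inv (x : heis) : heis := (- x.1, - x.2).
Definition heis_one : heis := (0, 0).

Fact heis_mulA : associative heis_mul.
Proof.
move=> x y z; congr (_, _) => /=; first exact: addrA.
rewrite heis_formDl heis_formDr.
move: (b _ _) (b _ _) (b _ _) => B1 B2 B3.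
by apply/matrixP => i j; rewrite !mxE; ring.
Qed.

Fact heis_mul1 : left_id heis_one heis_mul.
Proof. by case=> X S; rewrite /heis_mul /= !add0r heis_form0l addr0. Qed.

Fact heis_mulV : left_inverse heis_one heis_inv heis_mul.
Proof.
by case=> X S; rewrite /heis_mul /= !addNr heis_formNl heis_formXX oppr0 addr0.
Qed.

HB.instance Definition _ := Finite_isGroup.Build heis heis_mulA heis_mul1 heis_mulV.

Lemma heisM (x y : heis) : (x * y)%g = (x.1 + y.1, x.2 + y.2 + b x.1 y.1).
Proof. by []. Qed.

Lemma heisX (x : heis) k : (x ^+ k)%g = (x.1 *+ k, x.2 *+ k).
Proof.
elim: k => [|k IH]; first by rewrite expg0 !mulr0n.
rewrite expgS IH heisM /= -!mulrS; congr (_, _).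
by rewrite heis_formXMn addr0.
Qed.

Lemma heisR (x y : heis) : [~ x, y]%g = (0, b x.1 y.1 *+ 2).
Proof.
apply: (mulgI (y * x)%g); rewrite -commgC !heisM /= heis_form0r !addr0.
congr (_, _); first by rewrite addrC.
rewrite (heis_form_sym x.1 y.1) mulr2n; move: (b _ _) => B.
by apply/matrixP => i j; rewrite !mxE; ring.
Qed.

(** Commutators have skew second coordinate; restricting to skew matrices makes [skew_center] the
    derived subgroup. *)
Definition skew_pairs : {set heis} := [set x : heis | x.2^T == - x.2].
Local Notation P := skew_pairs.

Fact skew_pairs_group : group_set P.
Proof.
apply/group_setP; split=> [|x y]; first by rewrite inE trmx0 oppr0.
rewrite !inE => /eqP Sx /eqP Sy; rewrite heisM /=.
have trD (A B : 'M[F]_3) : (A + B)^T = A^T + B^T by rewrite linearD.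
by rewrite trD heis_form_tr trD Sx Sy !opprD.
Qed.
Canonical skew_pairs_groupType := Group skew_pairs_group.

Definition skew_center : {set heis} := [set x in P | x.1 == 0].
Local Notation W := skew_center.

Fact skew_center_group : group_set W.
Proof.
apply/group_setP; split=> [|x y]; first by rewrite inE group1 eqxx.
move=> /setIdP[Px /eqP x0] /setIdP[Py /eqP y0].
by rewrite inE groupM //= x0 y0 addr0 eqxx.
Qed.
Canonical skew_center_groupType := Group skew_center_group.

Lemma mem_W (S : 'M[F]_3) : S^T = - S -> ((0, S) : heis) \in W.
Proof. by move=> skS; rewrite !inE /= skS !eqxx. Qed.

Lemma W_sub_P : W \subset P.
Proof. by apply/subsetP => x; rewrite inE => /andP[]. Qed.

(** The full preimage in [P] of the subspace [x (x) F^3]. *)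
Definition line (x : 'cV[F]_n) : {set heis} :=
  [set y in P | [exists u : 'rV[F]_3, y.1 == x *m u]].

Lemma lineP x y : reflect (y \in P /\ exists u : 'rV[F]_3, y.1 = x *m u) (y \in line x).
Proof.
apply: (iffP setIdP) => -[Py yx]; split=> //.
  by have /existsP[u /eqP] := yx; exists u.
by have [u yu] := yx; apply/existsP; exists u; apply/eqP.
Qed.

Fact line_group x : group_set (line x).
Proof.
apply/group_setP; split=> [|y z].
  by apply/lineP; split; [apply: group1 | exists 0; rewrite mulmx0].
move=> /lineP[Py [u yu]] /lineP[Pz [v zv]]; apply/lineP.
by split; [apply: groupM | exists (u + v); rewrite /= yu zv mulmxDr].
Qed.
Canonical line_groupType x := Group (line_group x).

Lemma mem_line x (u : 'rV[F]_3) : ((x *m u, 0) : heis) \in line x.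
Proof. by apply/lineP; split; [rewrite inE trmx0 oppr0 | exists u]. Qed.

Lemma W_sub_line x : W \subset line x.
Proof.
apply/subsetP => y /setIdP[Py /eqP y0]; apply/lineP.
by split=> //; exists 0; rewrite mulmx0.
Qed.

Lemma line_sub_P x : line x \subset P.
Proof. by apply/subsetP => y /lineP[]. Qed.

Lemma lineZ c x : c != 0 -> line (c *: x) = line x.
Proof.
move=> c0; apply/setP => y; apply/lineP/lineP => -[Py [u yu]]; split=> //.
  by exists (c *: u); rewrite yu -scalemxAl -scalemxAr.
by exists (c^-1 *: u); rewrite yu -scalemxAl -scalemxAr scalerA divff // scale1r.
Qed.

Lemma P_sub_cent_W : P \subset 'C(W)%g.
Proof.
apply/centsP => x Px y; case/setIdP=> _ /eqP y0.
by apply/commgP; rewrite heisR y0 heis_form0r mul0rn.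
Qed.

Lemma W_sub_center : W \subset 'Z(P)%g.
Proof. by rewrite subsetI W_sub_P centsC P_sub_cent_W. Qed.

Hypotheses (p_pr : prime p) (p_odd : odd p).

Let p_char : p%:R = 0 :> F. Proof. exact: pcharf0 (pchar_Fp p_pr). Qed.

Let two_unit : 2%:R != 0 :> F := two_neq0 p_pr p_odd.

Lemma heis_exp (x : heis) : (x ^+ p)%g = 1%g.
Proof. by rewrite heisX -!scaler_nat p_char !scale0r. Qed.

Lemma heis_pgroup : (p.-group P)%g.
Proof.
apply: (pgroupS (subsetT P)).
rewrite /pgroup cardsT card_prod !card_mx card_Fp // -expnD.
by rewrite pnatX pnat_id.
Qed.

Lemma line_coef x (u : 'rV[F]_3) y (v : 'rV[F]_3) :
  b (x *m u) (y *m v) = (x^T *m y) 0 0 *: wedge u v.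
Proof.
rewrite heis_form_col; have -> : y^T *m (x *m u) = (x^T *m y) 0 0 *: u.
  rewrite mulmxA [y^T *m x]mx11_scalar mul_scalar_mx.
  by congr (_ *: _); rewrite -[y^T *m x]trmxK trmx_mul trmxK mxE.
by rewrite wedgeZl.
Qed.

Lemma line_der x : (x^T *m x) 0 0 != 0 -> (line x)^`(1)%g = W.
Proof.
set a := _ 0 0 => a0; apply/eqP; rewrite eqEsubset; apply/andP; split.
  rewrite gen_subG; apply/subsetP => _ /imset2P[y z Ly Lz ->].
  by rewrite heisR; apply: mem_W; rewrite linearMn /= heis_form_tr mulNrn.
apply/subsetP => -[X S]; rewrite !inE /= => /andP[/eqP skS /eqP ->] {X}.
pose T := [set S : 'M[F]_3 | ((0, S) : heis) \in (line x)^`(1)%g].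
have T0 : 0 \in T by rewrite inE; apply: group1.
have TD S1 S2 : S1 \in T -> S2 \in T -> S1 + S2 \in T.
  rewrite !inE => T1 T2; have := groupM T1 T2.
  by rewrite heisM /= heis_form0l !addr0.
have TE u v : wedge u v \in T.
  (* The scalar cancels the factor 2 of the commutator and the norm [a] of [x]. *)
  have := mem_commg (mem_line x ((2%:R * a)^-1 *: u)) (mem_line x v).
  rewrite heisR /= line_coef -/a -scaler_nat wedgeZl !scalerA.
  by rewrite divff ?scale1r ?mulf_neq0 // inE.
suff : S \in T by rewrite inE.
(* A skew matrix is half of [S - S^T], hence a combination of wedges of basis vectors. *)
have -> : S = \sum_i \sum_j wedge ((2%:R^-1 * S i j) *: delta_mx 0 i) (delta_mx 0 j).
  transitivity (2%:R^-1 *: (S - S^T)).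
    by rewrite skS opprK -mulr2n -scaler_nat scalerA mulVf // scale1r.
  rewrite {1 2}[S]matrix_sum_delta linear_sum -sumrB scaler_sumr.
  apply: eq_bigr => i _; rewrite linear_sum -sumrB scaler_sumr; apply: eq_bigr => j _.
  rewrite linearZ /= trmx_delta -scalerBr scalerA wedgeZl; congr (_ *: _).
  by rewrite /wedge !trmx_delta !mul_delta_mx.
by elim/big_ind: _ => // i _; elim/big_ind: _.
Qed.

Hypothesis n_gt0 : (0 < n)%N.

Let line_unit : exists x : 'cV[F]_n, (x^T *m x) 0 0 != 0.
Proof.
exists (delta_mx (Ordinal n_gt0) 0).
by rewrite trmx_delta mul_delta_mx mxE !eqxx oner_eq0.
Qed.

Lemma heis_der : P^`(1)%g = W.
Proof.
apply/eqP; rewrite eqEsubset; apply/andP; split.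
  rewrite gen_subG; apply/subsetP => _ /imset2P[y z Py Pz ->].
  by rewrite heisR; apply: mem_W; rewrite linearMn /= heis_form_tr mulNrn.
have [x x0] := line_unit; rewrite -(line_der x0).
exact: dergS (line_sub_P x).
Qed.

Lemma heis_der_sub_center : P^`(1)%g \subset 'Z(P)%g.
Proof. by rewrite heis_der W_sub_center. Qed.

Lemma wedge_neq0 : wedge (delta_mx 0 0 : 'rV[F]_3) (delta_mx 0 1) != 0.
Proof.
apply/eqP => /matrixP/(_ 0 1); rewrite wedgeE !mxE !eqxx /=.
by rewrite mul0r subr0 mulr1 => /eqP; rewrite oner_eq0.
Qed.

Lemma W_neq1 : W != 1%g.
Proof.
apply/trivgPn; exists (0, wedge (delta_mx 0 0) (delta_mx 0 1)).
  by apply: mem_W; rewrite /wedge linearB /= !trmx_mul !trmxK opprB.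
by apply: contraNneq wedge_neq0 => -[->].
Qed.

Lemma heis_nil_class : nil_class P = 2.
Proof.
apply/eqP; rewrite eqn_leq nil_class2 heis_der_sub_center ltnNge nil_class1 /=.
by apply: contra W_neq1 => /derG1P; rewrite heis_der => ->.
Qed.

Lemma heis_exponent : exponent P = p.
Proof.
apply/prime_nt_dvdP => //; last by apply/exponentP => x _; apply: heis_exp.
rewrite -dvdn1; apply: contra W_neq1 => /exponentP P1.
by apply/eqP/trivgP/subsetP => x /(subsetP W_sub_P)/P1; rewrite expg1 => ->; apply: set11.
Qed.

Lemma heis_expP : {in P, forall x : heis, x ^+ p = 1}%g.
Proof. by move=> x _; apply: heis_exp. Qed.

Lemma commute_line (x : 'cV[F]_n) (u v : 'rV[F]_3) (y z : heis) : (x^T *m x) 0 0 != 0 ->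
  y.1 = x *m u -> z.1 = x *m v -> commute y z <-> wedge u v = 0.
Proof.
move=> a0 yu zv.
have -> : commute y z <-> [~ y, z]%g = 1%g by split=> [/commgP/eqP | /eqP/commgP].
rewrite heisR yu zv line_coef -scaler_nat scalerA; split=> [[] /eqP|->].
  by rewrite scaler_eq0 mulf_eq0 (negPf two_unit) (negPf a0) => /eqP.
by rewrite scaler0.
Qed.

Lemma mulcol_eq0 (x : 'cV[F]_n) (u : 'rV[F]_3) :
  (x^T *m x) 0 0 != 0 -> (x *m u == 0) = (u == 0).
Proof.
move=> a0; apply/eqP/eqP => [xu | ->]; last by rewrite mulmx0.
apply: (scalerI a0); rewrite scaler0 -mul_scalar_mx -mx11_scalar -mulmxA xu.
by rewrite mulmx0.
Qed.

(** Elements of the line commute only if their vectors are parallel. Two noncentral members would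
    make some noncentral [h] central in the line. With a single noncentral member the others lie in
    the Frattini subgroup [W], and that member is the whole line. *)
Lemma line_indecomposable (x : 'cV[F]_n) : (x^T *m x) 0 0 != 0 ->
  centrally_indecomposable (line x).
Proof.
move=> a0; have sLP := line_sub_P x.
have e0 : (delta_mx 0 0 : 'rV[F]_3) != 0.
  by apply/eqP => /rowP/(_ 0); rewrite !mxE => /eqP; rewrite oner_eq0.
have notW : ((x *m delta_mx 0 0, 0) : heis) \notin W.
  by apply/negP => /setIdP[_]; rewrite /= mulcol_eq0 // (negPf e0).
apply: (@indecomposableP _ (line_groupType x)) => [|Hs cd].
  apply: contraNneq notW => /= L1.
  by have := mem_line x (delta_mx 0 0); rewrite L1 => /set1P ->; apply: group1.
have /central_decompP[gHs cHs /= genL _] := cd.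
have [H HsH /subsetPn[h Hh notWh]] : exists2 H : {set heis}, H \in Hs & ~~ (H \subset W).
  apply/exists_inP; apply: contraNT notW => /exists_inPn sHs.
  suff /subsetP : line x \subset W by apply; apply: mem_line.
  rewrite -genL gen_subG; apply/bigcupsP => H /sHs.
  by rewrite negbK.
have [gH sHL] := gHs H HsH.
have notW0 y : y \in line x -> y \notin W -> exists2 u, y.1 = x *m u & u != 0.
  case/lineP=> Py [u yu]; rewrite inE Py yu /= mulcol_eq0 // => u0.
  by exists u.
have [u hu u0] := notW0 h (subsetP sHL h Hh) notWh.
have [/forall_inP sKW | ] := boolP [forall K in Hs, (K != H) ==> (K \subset W)].
  suff -> : line x = H by [].
  have /Phi_nongen : ('Phi(line_groupType x) <*> H = line_groupType x)%g.
    rewrite (Phi_exponent_p p_pr heis_pgroup heis_expP sLP) /= line_der //.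
    apply/eqP; rewrite eqEsubset gen_subG subUset W_sub_line sHL /= -{1}genL.
    rewrite gen_subG; apply/bigcupsP => K HsK.
    have [->|neqKH] := eqVneq K H; first exact: joing_subr.
    apply: subset_trans (joing_subl _ _).
    by have /implyP := sKW K HsK; apply.
  by rewrite -{1}[H]/(gval (Group gH)) genGid.
case/forall_inPn=> K HsK; rewrite negb_imply => /andP[neqKH /subsetPn[k Kk notWk]].
have [gK sKL] := gHs K HsK.
have [v kv v0] := notW0 k (subsetP sKL k Kk) notWk.
(* An element of [H] commutes with [k], so it is parallel to [k] and thereby to [h]; elements of
   other members commute with [h] anyway. *)
have sLC : line x \subset 'C[h]%g.
  rewrite -genL gen_subG; apply/bigcupsP => M HsM; apply/subsetP => y My.
  apply/cent1P; have [eqMH|neqMH] := eqVneq M H; last first.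
    exact/commute_sym/(centsP (cHs M H HsM HsH neqMH) h Hh y My).
  rewrite {M HsM}eqMH in My.
  have /lineP[_ [w yw]] := subsetP sHL y My.
  have cHK := cHs K H HsK HsH neqKH.
  have /(commute_line a0 yw kv) wv := centsP cHK y My k Kk.
  have /(commute_line a0 hu kv) uv := centsP cHK h Hh k Kk.
  apply/(commute_line a0 yw hu); apply: wedge_trans v0 wv _.
  by rewrite wedge_sym uv oppr0.
case/eqP: u0; apply: wedge_nondegenerate => j.
have ej : ((x *m delta_mx 0 j, 0) : heis).1 = x *m delta_mx 0 j by [].
have /(subsetP sLC)/cent1P/(commute_line a0 ej hu) := mem_line x (delta_mx 0 j).
by rewrite wedge_sym => /eqP; rewrite oppr_eq0 => /eqP.
Qed.

Definition frame_decomp (Q : 'M[F]_n) : {set {set heis}} :=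
  [set line (col i Q) | i : 'I_n].

Definition orthogonal_frame (Q : 'M[F]_n) (a : 'rV[F]_n) :=
  Q^T *m Q = diag_mx a /\ forall i, a 0 i != 0.

(** * Decompositions given by orthogonal frames *)

Section Frame.
Variables (Q : 'M[F]_n) (a : 'rV[F]_n).
Hypothesis frameQ : orthogonal_frame Q a.

Lemma frame_dot i j : ((col i Q)^T *m col j Q) 0 0 = a 0 i *+ (i == j).
Proof.
have [QQ _] := frameQ; move/matrixP/(_ i j): QQ; rewrite !mxE => <-.
by apply: eq_bigr => k _; rewrite !mxE.
Qed.

Lemma frame_norm i : ((col i Q)^T *m col i Q) 0 0 != 0.
Proof. by have [_ a0] := frameQ; rewrite frame_dot eqxx a0. Qed.

Lemma frame_unit : Q \in unitmx.
Proof.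
have [QQ a0] := frameQ.
have : Q^T *m Q \in unitmx.
  by rewrite QQ unitmxE det_diag unitfE; apply/prodf_neq0 => i _; apply: a0.
by rewrite unitmx_mul => /andP[].
Qed.

Lemma frame_dot_mul i j (u : 'rV[F]_3) :
  (col i Q)^T *m (col j Q *m u) = (a 0 i *+ (i == j)) *: u.
Proof.
by rewrite mulmxA [(col i Q)^T *m col j Q]mx11_scalar frame_dot mul_scalar_mx.
Qed.

Lemma frame_dot_neq0 i : (col i Q)^T *m (col i Q *m delta_mx 0 0) != 0 :> 'rV[F]_3.
Proof.
rewrite frame_dot_mul eqxx mulr1n scaler_eq0 negb_or; have [_ -> /=] := frameQ.
by apply/eqP => /rowP/(_ 0); rewrite !mxE => /eqP; rewrite oner_eq0.
Qed.

Lemma frame_line_inj : injective (fun i => line (col i Q)).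
Proof.
move=> i j eq_ij; apply/eqP; apply: contraT => neq_ij.
have := mem_line (col i Q) (delta_mx 0 0); rewrite eq_ij => /lineP[_ [u eu]].
have := frame_dot_neq0 i.
have -> : col i Q *m delta_mx 0 0 = col j Q *m u by [].
by rewrite frame_dot_mul (negPf neq_ij) mulr0n scale0r eqxx.
Qed.

Lemma card_frame_decomp : #|frame_decomp Q| = n.
Proof. by rewrite (card_imset _ frame_line_inj) card_ord. Qed.

Lemma frame_fully_refined : fully_refined P (frame_decomp Q).
Proof.
apply/andP; split; last first.
  by apply/forall_inP => _ /imsetP[i _ ->]; apply/line_indecomposable/frame_norm.
apply/(@central_decompP _ skew_pairs_groupType); split.
- by move=> _ /imsetP[i _ ->]; rewrite groupP line_sub_P.
- move=> _ _ /imsetP[i _ ->] /imsetP[j _ ->] neq_ij.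
  have {}neq_ij : i != j by apply: contraNneq neq_ij => ->.
  apply/centsP => y /lineP[_ [u yu]] z /lineP[_ [v zv]]; apply/commgP.
  by rewrite heisR yu zv line_coef frame_dot [j == i]eq_sym (negPf neq_ij) scale0r mul0rn.
- set G := <<_>>%g; apply/eqP; rewrite eqEsubset; apply/andP; split.
    by rewrite gen_subG; apply/bigcupsP => _ /imsetP[i _ ->]; apply: line_sub_P.
  have sLG i : line (col i Q) \subset G.
    by apply: sub_gen; apply: (bigcup_max (line (col i Q))) => //; apply: imset_f.
  have sWG : W \subset G := subset_trans (W_sub_line _) (sLG (Ordinal n_gt0)).
  (* First coordinates of elements of [G]: closed under sums and containing each [col i Q *m u], so
     everything, as [Q] is invertible. The second coordinate is then corrected within [W]. *)
  pose T := [set X : 'M[F]_(n, 3) | [exists S : 'M[F]_3, ((X, S) : heis) \in G]].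
  have T0 : 0 \in T by rewrite inE; apply/existsP; exists 0; apply: group1.
  have TD X Y : X \in T -> Y \in T -> X + Y \in T.
    rewrite !inE => /existsP[S GS] /existsP[S' GS']; apply/existsP.
    by exists (S + S' + b X Y); have := groupM GS GS'.
  have TQ i u : col i Q *m u \in T.
    by rewrite inE; apply/existsP; exists 0; apply/(subsetP (sLG i))/mem_line.
  apply/subsetP => -[X S] PX.
  have /existsP[S' GS'] : [exists S : 'M[F]_3, ((X, S) : heis) \in G].
    suff : X \in T by rewrite inE.
    rewrite -[X](mulKVmx frame_unit) mulmx_sum_col_row.
    by elim/big_ind: _.
  rewrite -(mulKVg ((X, S') : heis) (X, S)) groupM // (subsetP sWG) //.
  have PX' : ((X, S') : heis) \in P.
    have sGP : G \subset P.
      by rewrite gen_subG; apply/bigcupsP => _ /imsetP[i _ ->]; apply: line_sub_P.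
    exact: (subsetP sGP).
  by rewrite inE groupM ?groupV //= addNr.
move=> _ /imsetP[i _ ->]; apply/eqP => genP.
(* The subgroup orthogonal to column [i] contains all the other lines but not line [i]. *)
pose K := [set y in P | (col i Q)^T *m y.1 == 0].
have gK : group_set K.
  apply/group_setP; split=> [|y z]; first by rewrite inE group1 mulmx0 eqxx.
  move=> /setIdP[Py /eqP y0] /setIdP[Pz /eqP z0].
  by rewrite inE groupM //= mulmxDr y0 z0 addr0.
have : P \subset Group gK.
  rewrite -{1}genP gen_subG; apply/bigcupsP => H /setD1P[neq_ij /imsetP[j _ eqj]].
  rewrite eqj in neq_ij *; apply/subsetP => y /lineP[Py [u yu]].
  have neq_ij' : i != j by apply: contraNneq neq_ij => ->.
  by rewrite inE Py yu frame_dot_mul (negPf neq_ij') mulr0n scale0r eqxx.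
have Pi := subsetP (line_sub_P _) _ (mem_line (col i Q) (delta_mx 0 0)).
move/subsetP/(_ _ Pi)/setIdP => [_ i0].
by have := frame_dot_neq0 i; rewrite i0.
Qed.

End Frame.

Lemma frame_id : orthogonal_frame 1%:M (const_mx 1).
Proof.
split; last by move=> i; rewrite mxE oner_eq0.
by rewrite trmx1 mulmx1 diag_const_mx.
Qed.

Lemma skew_pairs_neq1 : P != 1%g.
Proof.
by apply: contraNneq W_neq1 => P1; rewrite -subG1 -P1 W_sub_P.
Qed.

Let fstM : {in P &, forall x y : heis, (x * y)%g.1 = x.1 + y.1}.
Proof. by []. Qed.

Let fst_onto (X : 'M[F]_(n, 3)) : exists2 x : heis, x \in P & x.1 = X.
Proof. by exists (X, 0); rewrite // inE trmx0 oppr0. Qed.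

Let ker_fst : {in P, forall x : heis, (x.1 == 0) = (x \in P^`(1)%g)}.
Proof.
move=> x Px; rewrite heis_der.
by apply/eqP/setIdP => [-> | [_ /eqP]].
Qed.

(** * Every fully refined decomposition comes from a frame *)

Section FullyRefined.
Variable Hs : {set {set heis}}.
Hypothesis frHs : fully_refined P Hs.

(** The uniqueness part of the theorem is applied: the standard frame has [n] members. *)
Lemma card_fully_refined : #|Hs| = n.
Proof.
have [-> _ _] := fr_unique p_pr p_odd heis_pgroup skew_pairs_neq1 heis_expP
  heis_der_sub_center frHs (frame_fully_refined frame_id).
exact: card_frame_decomp frame_id.
Qed.

Local Notation proj := (projection (fun x : heis => x.1) Hs).

Section Member.
Variable H : {set heis}.
Hypothesis HsH : H \in Hs.

Lemma proj_form X Y : b (proj H X) Y = b X (proj H Y).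
Proof.
have formE Z T : commutator_form [group of P] (fun x : heis => x.1) Z T = (0, b Z T *+ 2).
  have PZ Z' : ((Z', 0) : heis) \in P by rewrite inE trmx0 oppr0.
  rewrite -[Z in LHS]/((Z, 0) : heis).1 -[T in LHS]/((T, 0) : heis).1.
  rewrite (commutator_formE heis_der_sub_center fstM fst_onto ker_fst) ?PZ //.
  by rewrite heisR.
have := projection_sym p_pr heis_pgroup heis_expP heis_der_sub_center fstM
  fst_onto ker_fst frHs HsH X Y.
rewrite !formE => -[]; rewrite -!scaler_nat => /(scalerI two_unit).
by [].
Qed.

Lemma projD X Y : proj H (X + Y) = proj H X + proj H Y.
Proof.
exact: (projectionD p_pr heis_pgroup heis_expP heis_der_sub_center fstM
  fst_onto ker_fst frHs HsH).
Qed.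

Definition proj_mx : 'M[F]_n := \matrix_(l, k) proj H (delta_mx k 0) l 0.

(** Cut the projection into blocks [phi k l] on [F^3]. Self-adjointness makes the blocks [(k, l)]
    and [(l, k)] adjoint for the wedge product, hence the same scalar; so the projection is a
    symmetric matrix tensored with the identity. *)
Lemma proj_mxP : (forall X, proj H X = proj_mx *m X) /\ proj_mx^T = proj_mx.
Proof.
pose phi k l (u : 'rV[F]_3) := row l (proj H ((delta_mx k 0 : 'cV_n) *m u)).
have phi_adj k l u v : wedge (phi k l u) v = wedge u (phi l k v).
  have colE' i Z w : b Z ((delta_mx i 0 : 'cV_n) *m w) = wedge (row i Z) w.
    by rewrite heis_form_col trmx_delta -rowE.
  by rewrite -colE' proj_form heis_form_sym colE' -wedge_sym.
have lamE k l u : phi k l u = proj_mx l k *: u.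
  have [fE _] := adjoint_wedge (phi_adj k l).
  by rewrite fE /phi mul_delta_mx !mxE.
have proj0 : proj H 0 = 0 by apply: (addrI (proj H 0)); rewrite -projD !addr0.
split=> [X|].
  rewrite -{1}[X]mul1mx mulmx_sum_col_row (big_morph _ projD proj0).
  apply/row_matrixP => l; rewrite linear_sum row_mul mulmx_sum_row.
  apply: eq_bigr => k _; rewrite mxE -lamE /phi colE mul1mx //.
apply/matrixP => l k; rewrite mxE.
have [_] := adjoint_wedge (phi_adj l k).
by rewrite !lamE !mxE !eqxx !mulr1.
Qed.

End Member.
Lemma proj_mx_fix H : H \in Hs ->
  {in H, forall h : heis, proj_mx H *m h.1 = h.1}.
Proof.
move=> HsH h Hh; have [<- _] := proj_mxP HsH.
exact: (projection_id p_pr heis_pgroup heis_expP heis_der_sub_center fstM ker_fst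
  frHs HsH Hh).
Qed.

Lemma proj_mx_img H (X : 'M[F]_(n, 3)) : H \in Hs ->
  exists2 h : heis, h \in H & proj_mx H *m X = h.1.
Proof.
move=> HsH; have [<- _] := proj_mxP HsH.
exact: (projection_mem p_pr heis_pgroup heis_expP heis_der_sub_center fstM
  fst_onto ker_fst frHs HsH).
Qed.

Lemma mulmx_col0_inj (A B : 'M[F]_n) :
  (forall X : 'M[F]_(n, 3), A *m X = B *m X) -> A = B.
Proof.
move=> AB; apply/matrixP => i j.
have /matrixP/(_ i 0) := AB (delta_mx j 0).
suff entry (C : 'M[F]_n) : (C *m (delta_mx j 0 : 'M_(n, 3))) i 0 = C i j.
  by rewrite !entry.
rewrite mxE (bigD1 j) //= big1 ?addr0 => [|k neq_kj]; rewrite mxE eqxx.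
  by rewrite eqxx mulr1.
by rewrite (negPf neq_kj) mulr0.
Qed.

Lemma proj_mxM H K : H \in Hs -> K \in Hs ->
  proj_mx H *m proj_mx K = if H == K then proj_mx K else 0.
Proof.
move=> HsH HsK; apply: mulmx_col0_inj => X; rewrite -mulmxA.
have [k Kk kX] := proj_mx_img X HsK; rewrite kX.
have [eqHK|neqHK] := eqVneq H K; first by rewrite kX eqHK proj_mx_fix.
rewrite mul0mx; have [<- _] := proj_mxP HsH.
apply: (projection_other p_pr heis_pgroup heis_expP heis_der_sub_center fstM
  ker_fst frHs HsK HsH _ Kk).
by rewrite eq_sym.
Qed.

Lemma proj_mx_neq0 H : H \in Hs -> proj_mx H != 0.
Proof.
move=> HsH; have [h Hh] := fr_pi_neq0 p_pr heis_pgroup heis_expP ker_fst frHs HsH.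
by apply: contraNneq => G0; rewrite -(proj_mx_fix HsH Hh) G0 mul0mx.
Qed.

Lemma proj_mx_vector H : H \in Hs ->
  exists v : 'cV[F]_n, v != 0 /\ proj_mx H *m v = v.
Proof.
move=> HsH; have /matrix0Pn[i [j Gij]] := proj_mx_neq0 HsH.
exists (col j (proj_mx H)); split.
  by apply/cV0Pn; exists i; rewrite mxE.
by rewrite colE mulmxA proj_mxM // eqxx.
Qed.

(** [H] lies in the line and covers it modulo [W], the Frattini subgroup of the line. *)
Lemma line_eq H (x : 'cV[F]_n) (r : 'rV[F]_n) : H \in Hs ->
  (x^T *m x) 0 0 != 0 -> proj_mx H = x *m r -> proj_mx H *m x = x -> H = line x.
Proof.
move=> HsH a0 GE Gx.
have [K defH [sKP _ _ _ _]] := fr_group frHs HsH.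
have sHL : H \subset line x.
  apply/subsetP => h Hh; apply/lineP; split.
    by rewrite defH in Hh; exact: subsetP Hh.
  by exists (r *m h.1); rewrite -{1}(proj_mx_fix HsH Hh) GE mulmxA.
suff /Phi_nongen : ('Phi(line_groupType x) <*> H = line_groupType x)%g.
  by rewrite defH genGid.
rewrite (Phi_exponent_p p_pr heis_pgroup heis_expP (line_sub_P x)) /= line_der //.
apply/eqP; rewrite eqEsubset gen_subG subUset W_sub_line sHL /=.
apply/subsetP => y /lineP[Py [u yu]].
have [h Hh] := proj_mx_img (x *m u) HsH; rewrite mulmxA Gx => hE.
have Ph : h \in P by apply: (subsetP sKP); rewrite -defH.
rewrite -(mulKVg h y) groupM //; first exact: (subsetP (joing_subr _ _)).
apply: (subsetP (joing_subl _ _)).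
apply/setIdP; split; first by rewrite groupM ?groupV.
by rewrite /= yu hE addNr.
Qed.

(** The [n] nonzero orthogonal idempotent matrices in dimension [n] have rank one. Vectors fixed by
    them form a basis, orthogonal because the matrices are symmetric, and the norms are nonzero
    because the Gram matrix is invertible. *)
Lemma fully_refined_frame :
  exists Q a, orthogonal_frame Q a /\ Hs = frame_decomp Q.
Proof.
pose Hi (i : 'I_n) := enum_val (cast_ord (esym card_fully_refined) i).
have HsHi i : Hi i \in Hs by apply: enum_valP.
have Hi_inj : injective Hi by move=> i j /enum_val_inj/cast_ord_inj.
have [f fP] := fin_all_exists (fun i => proj_mx_vector (HsHi i)).
pose Q : 'M[F]_n := \matrix_(r, i) f i r 0.
have colQ i : col i Q = f i by apply/colP => r; rewrite !mxE.
have GQ i j : proj_mx (Hi i) *m col j Q = if i == j then col j Q else 0.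
  have [_ fj] := fP j; rewrite colQ -{1}fj mulmxA proj_mxM // (inj_eq Hi_inj).
  by case: eqP; rewrite ?mul0mx.
have dot0 i j : i != j -> (col i Q)^T *m col j Q = 0.
  move=> neq_ij; have [_ trG] := proj_mxP (HsHi i).
  have := GQ i i; rewrite eqxx => {1}<-.
  by rewrite trmx_mul trG -mulmxA GQ (negPf neq_ij) mulmx0.
have Q_unit : Q \in unitmx.
  rewrite -unitmx_tr -row_free_unit; apply: inj_row_free => v vQ.
  apply/rowP => i; rewrite mxE.
  have : Q *m v^T = 0 by rewrite -[LHS]trmxK trmx_mul trmxK vQ trmx0.
  move/(congr1 (mulmx (proj_mx (Hi i)))); rewrite mulmx0 (mulmx_sum_col_row Q) mulmx_sumr.
  rewrite (bigD1 i) //= big1 ?addr0 => [|j neq_ji].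
    rewrite mulmxA GQ eqxx [row i _]mx11_scalar mul_mx_scalar !mxE => /eqP.
    by rewrite scaler_eq0 colQ (negPf (proj1 (fP i))) orbF => /eqP.
  by rewrite mulmxA GQ eq_sym (negPf neq_ji) mul0mx.
pose a : 'rV[F]_n := \row_i ((col i Q)^T *m col i Q) 0 0.
have QQ : Q^T *m Q = diag_mx a.
  apply/matrixP => i j; rewrite !mxE.
  transitivity (((col i Q)^T *m col j Q) 0 0).
    by rewrite mxE; apply: eq_bigr => k _; rewrite !mxE.
  have [<-|neq_ij] := eqVneq i j; first by rewrite mulr1n mxE.
  by rewrite dot0 // mxE mulr0n.
have a0 i : a 0 i != 0.
  have : Q^T *m Q \in unitmx by rewrite unitmx_mul unitmx_tr Q_unit.
  rewrite QQ unitmxE det_diag unitfE => /prodf_neq0; exact.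
exists Q, a; split=> //.
have HiL i : Hi i = line (col i Q).
  apply: (@line_eq _ _ (delta_mx 0 i *m invmx Q)) => //.
  - by have := a0 i; rewrite mxE.
  - rewrite mulmxA -[LHS](mulmxK Q_unit); congr (_ *m _).
    apply/matrixP => r j.
    transitivity ((proj_mx (Hi i) *m col j Q) r 0).
      by rewrite !mxE; apply: eq_bigr => k _; rewrite !mxE.
    rewrite GQ !mxE big_ord1 !mxE eqxx /= eq_sym.
    by case: eqP => [->|_]; rewrite !mxE ?mulr1 ?mulr0.
  - by rewrite GQ eqxx.
apply/setP => H; apply/idP/imsetP => [HsH|[i _ ->]]; last by rewrite -HiL.
exists (cast_ord card_fully_refined (enum_rank_in HsH H)) => //.
by rewrite -HiL /Hi cast_ordK enum_rankK_in.
Qed.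

End FullyRefined.

Lemma frame_entry (Q : 'M[F]_n) i j : (Q^T *m Q) i j = ((col i Q)^T *m col j Q) 0 0.
Proof. by rewrite !mxE; apply: eq_bigr => k _; rewrite !mxE. Qed.

Lemma dotZ (c d : F) (x y : 'cV[F]_n) :
  ((c *: x)^T *m (d *: y)) 0 0 = c * d * (x^T *m y) 0 0.
Proof.
have -> : (c *: x)^T = c *: x^T by rewrite linearZ.
by rewrite -scalemxAl -scalemxAr scalerA mxE.
Qed.

Variable w : F.
Hypothesis nsq_w : ~~ is_square w.

Let w0 : w != 0.
Proof.
by apply: contraNneq nsq_w => ->; apply/is_squareP; exists 0; rewrite expr0n.
Qed.

Definition normal_diag (k : nat) : 'rV[F]_n := \row_i (if (i < k)%N then w else 1).

(** Rescaling a column leaves its line unchanged and multiplies the norm by a square; reordering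
    puts the nonsquare norms first. *)
Lemma fully_refined_normal Hs : fully_refined P Hs ->
  exists k Q, [/\ (k <= n)%N, orthogonal_frame Q (normal_diag k) &
                  Hs = frame_decomp Q].
Proof.
case/fully_refined_frame=> Q [a [frameQ ->]]; have [_ a0] := frameQ.
pose bad i := ~~ is_square (a 0 i).
pose t := filter bad (enum 'I_n) ++ filter (predC bad) (enum 'I_n).
pose k := size (filter bad (enum 'I_n)).
have perm_t : perm_eq t (enum 'I_n) by rewrite perm_filterC.
have size_t : size t = n by rewrite (perm_size perm_t) size_enum_ord.
have uniq_t : uniq t by rewrite (perm_uniq perm_t) enum_uniq.
pose s (i : 'I_n) := nth i t i.
have s_inj : injective s.
  move=> i j /eqP; rewrite /s (set_nth_default j) ?size_t //.
  by rewrite nth_uniq ?size_t // => /eqP/val_inj.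
have bad_s i : bad (s i) = (i < k)%N.
  rewrite /s /t nth_cat -/k; case: ltnP => [lt_ik | le_ki].
    by have := mem_nth i lt_ik; rewrite mem_filter => /andP[].
  apply/negbTE; have : (i - k < size (filter (predC bad) (enum 'I_n)))%N.
    rewrite -(ltn_add2l k) subnKC //; have := size_t; rewrite size_cat -/k => ->.
    exact: ltn_ord.
  by move/(mem_nth i); rewrite mem_filter => /andP[].
have /fin_all_exists[c cP] i :
    exists c : F, c != 0 /\ c ^+ 2 * a 0 (s i) = normal_diag k 0 i.
  rewrite mxE -bad_s; case: ifP => [bad_i | /negbFE].
    have /is_squareP[r r2] := nonsquareM bad_i nsq_w.
    have r0 : r != 0.
      by rewrite -(sqrf_eq0 r) -r2 mulf_neq0.
    (* As [a 0 (s i) * w = r ^+ 2], this scaling changes the norm into [w]. *)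
    exists (w / r); split; first by rewrite mulf_neq0 ?invr_neq0.
    by rewrite expr_div_n -r2; field; rewrite w0 a0.
  case/is_squareP=> r r2; have r0 : r != 0 by rewrite -(sqrf_eq0 r) -r2.
  exists r^-1; split; first by rewrite invr_neq0.
  by rewrite r2 -exprMn mulVf // expr1n.
pose Q' : 'M[F]_n := \matrix_(r, i) (c i * Q r (s i)).
have colQ' i : col i Q' = c i *: col (s i) Q.
  by apply/colP => r; rewrite !mxE.
exists k, Q'; split.
- by rewrite -size_t size_cat leq_addr.
- split=> [|i]; last by rewrite mxE; case: ifP; rewrite ?oner_eq0.
  apply/matrixP => i j; rewrite frame_entry !colQ' [in RHS]mxE.
  rewrite dotZ (frame_dot frameQ) (inj_eq s_inj).
  have [<-|_] := eqVneq i j; last by rewrite !mulr0n mulr0.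
  by rewrite !mulr1n -expr2; have [] := cP i.
apply/setP => H; apply/imsetP/imsetP => -[i _ ->].
  have [s' sK s'K] := injF_bij s_inj.
  exists (s' i); [by []|rewrite colQ' s'K lineZ; first by []].
  exact: (proj1 (cP _)).
exists (s i); [by []|rewrite colQ' lineZ; first by []].
exact: (proj1 (cP _)).
Qed.

End Heisenberg.

(** * Orbits *)

Section DecompAction.
Local Open Scope group_scope.
Variables (gT : finGroupType) (P : {group gT}).
Implicit Types Hs Ks : {set {set gT}}.

Lemma decomp_act1 Hs : decomp_act 1 Hs = Hs.
Proof.
have act1 (H : {set gT}) : [set (1 : {perm gT}) x | x in H] = H.
  by rewrite (eq_imset _ (perm1 (T := gT))) imset_id.
by rewrite /decomp_act (eq_imset _ act1) imset_id.
Qed.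

Lemma decomp_actM a b Hs : decomp_act (a * b) Hs = decomp_act b (decomp_act a Hs).
Proof.
rewrite /decomp_act -imset_comp; apply: eq_imset => H /=.
by rewrite -imset_comp; apply: eq_imset => x /=; rewrite permM.
Qed.

Lemma decomp_orbit_eqP Hs Ks :
  reflect (exists2 a, a \in Aut P & Ks = decomp_act a Hs)
          ([set decomp_act a Hs | a in Aut P] == [set decomp_act a Ks | a in Aut P]).
Proof.
apply: (iffP eqP) => [eq_orb | [a Aa ->]].
  have : Ks \in [set decomp_act a Ks | a in Aut P].
    by apply/imsetP; exists 1; rewrite ?group1 // decomp_act1.
  by rewrite -eq_orb => /imsetP[a Aa ->]; exists a.
apply/setP => Ls; apply/imsetP/imsetP => -[b Ab ->].
  by exists (a^-1 * b); rewrite ?groupM ?groupV // -decomp_actM mulKVg.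
by exists (a * b); rewrite ?groupM // decomp_actM.
Qed.

End DecompAction.

Lemma card_ord_lt (n k : nat) : k <= n -> #|[set i : 'I_n | i < k]| = k.
Proof.
move=> le_kn; rewrite -sum1_card -[RHS](card_ord k) -[in RHS]sum1_card.
by rewrite (big_ord_widen n (fun=> 1%N) le_kn); apply: eq_bigl => i; rewrite inE.
Qed.

Section Orbits.
Import GRing.Theory.
Local Open Scope ring_scope.
Variables (p n : nat).
Local Notation F := 'F_p.
Local Notation P := (skew_pairs p n).
Local Notation b := (@heis_form p n).
Hypotheses (p_pr : prime p) (p_odd : odd p) (n_gt0 : (0 < n)%N).
Variable w : F.
Hypothesis nsq_w : ~~ is_square w.

Let w0 : w != 0.
Proof.
by apply: contraNneq nsq_w => ->; apply/is_squareP; exists 0; rewrite expr0n.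
Qed.

(** The determinant of the Gram matrix is a square and equals [w ^+ k]. *)
Lemma normal_even (Q : 'M[F]_n) k : (k <= n)%N ->
  orthogonal_frame Q (normal_diag n w k) -> ~~ odd k.
Proof.
move=> le_kn [QQ _]; apply: contra nsq_w => odd_k.
have : \det Q ^+ 2 = w ^+ k.
  rewrite expr2 -{1}det_tr -det_mulmx QQ det_diag.
  transitivity (\prod_(i < n) (if (i < k)%N then w else 1)).
    by apply: eq_bigr => i _; rewrite mxE.
  rewrite -big_mkcond -(big_ord_widen _ (fun=> w) le_kn) prodr_const card_ord //.
have kE : k = (k./2 * 2)%N.+1 by rewrite muln2 -[LHS]odd_double_half odd_k.
rewrite [in w ^+ k]kE (exprS w) exprM => eq_det.
apply/is_squareP; exists (\det Q / w ^+ k./2).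
by rewrite expr_div_n eq_det mulfK // expf_neq0 // expf_neq0.
Qed.

(** The matrix [g = R *m invmx Q] is orthogonal, so it preserves the form and acts on first
    coordinates as an automorphism. *)
Lemma isometry_orbit (Q R : 'M[F]_n) d :
  orthogonal_frame Q d -> orthogonal_frame R d ->
  exists2 a, a \in Aut P & frame_decomp R = decomp_act a (frame_decomp Q).
Proof.
move=> frameQ frameR; have [QQ _] := frameQ; have [RR _] := frameR.
have UQ := frame_unit frameQ.
have [g gg gQ] : exists2 g : 'M[F]_n, g^T *m g = 1%:M & g *m Q = R.
  exists (R *m invmx Q); last by rewrite mulmxKV.
  rewrite trmx_mul mulmxA -(mulmxA _ R^T) RR -QQ trmx_inv mulmxA mulVmx ?unitmx_tr //.
  by rewrite mul1mx mulmxV.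
have gK : cancel (mulmx g) (mulmx g^T : 'M[F]_(n, 3) -> _).
  by move=> X; rewrite mulmxA gg mul1mx.
pose f (x : heis p n) : heis p n := (g *m x.1, x.2).
have form_g X Y : b (g *m X) (g *m Y) = b X Y.
  by rewrite /heis_form !trmx_mul !mulmxA -!(mulmxA _ g^T) gg !mulmx1.
have fM : {in P &, {morph f : x y / (x * y)%g}}.
  by move=> x y _ _; rewrite !heisM /f /= form_g mulmxDr.
pose fm := Morphism fM.
have injf : ('injm fm)%g.
  apply/injmP => x y _ _ [/(can_inj gK) e1 e2].
  by rewrite (surjective_pairing x) e1 e2 -surjective_pairing.
have fP : (fm @* P)%g = P.
  apply/eqP; rewrite eqEcard card_injm // leqnn andbT.
  by apply/subsetP => _ /morphimP[x Px _ ->]; move: Px; rewrite !inE.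
have [a Aa aE] : exists2 a, a \in Aut P & {in P, a =1 f}.
  by exists (aut injf fP); [exact: Aut_aut | exact: autE].
exists a; first by [].
have f_line i : [set a x | x in line (col i Q)] = line (col i R).
  have gq : g *m col i Q = col i R by rewrite !colE mulmxA gQ.
  apply/setP => y; apply/imsetP/idP => [[x Lx ->] | /lineP[Py [u yu]]].
    have /lineP[Px [u xu]] := Lx; rewrite (aE x Px); apply/lineP; split.
      by move: Px; rewrite !inE.
    by exists u; rewrite /= xu mulmxA gq.
  have Px : ((col i Q *m u, y.2) : heis p n) \in P by move: Py; rewrite !inE.
  exists (col i Q *m u, y.2); first by apply/lineP; split; last by exists u.
  by rewrite (aE _ Px) /f /= mulmxA gq -yu -surjective_pairing.
rewrite /frame_decomp /decomp_act -imset_comp; apply: eq_imset => i.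
by rewrite [RHS]f_line.
Qed.

(** The other index of the coordinate plane containing index [m]. *)
Definition partner (m : nat) := if odd m then m.-1 else m.+1.

Lemma dot_bilinear (a1 a2 b1 b2 : F) (x1 x2 y1 y2 : 'cV[F]_n) :
  ((a1 *: x1 + a2 *: x2)^T *m (b1 *: y1 + b2 *: y2)) 0 0 =
  a1 * b1 * (x1^T *m y1) 0 0 + a1 * b2 * (x1^T *m y2) 0 0 +
  (a2 * b1 * (x2^T *m y1) 0 0 + a2 * b2 * (x2^T *m y2) 0 0).
Proof.
have dotE (x y : 'cV[F]_n) : (x^T *m y) 0 0 = \sum_k x k 0 * y k 0.
  by rewrite mxE; apply: eq_bigr => k _; rewrite mxE.
rewrite !dotE !mulr_sumr -!big_split; apply: eq_bigr => k _ /=.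
by rewrite !mxE; ring.
Qed.

(* As [w = c ^+ 2 + d ^+ 2], the similitude [[c, - d], [d, c]] of a coordinate plane
   turns two vectors of norm 1 into two orthogonal vectors of norm [w]; it is applied
   to the planes spanned by coordinates [2 m] and [2 m + 1] for [2 m < k]. *)
Lemma normal_frame_exists k (c d : F) : (k <= n)%N -> ~~ odd k ->
  w = c ^+ 2 + d ^+ 2 -> exists Q : 'M[F]_n, orthogonal_frame Q (normal_diag n w k).
Proof.
move=> le_kn even_k wE.
pose pr (i : 'I_n) : 'I_n := if (i < k)%N then insubd i (partner i) else i.
have prE (i : 'I_n) : (i < k)%N -> (pr i = partner i :> nat) /\ (partner i < k)%N.
  move=> lt_ik; have lt_pk : (partner i < k)%N.
    rewrite /partner; case: ifP => [_ | even_i].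
      exact: leq_ltn_trans (leq_pred i) lt_ik.
    rewrite ltn_neqAle lt_ik andbT; apply: contraNneq even_k => <-.
    by rewrite /= even_i.
  by rewrite /pr lt_ik val_insubd (leq_trans lt_pk le_kn).
have partnerK m : partner (partner m) = m.
  rewrite /partner; case E: (odd m); last by rewrite /= E.
  by case: m E => //= m; case: (odd m).
have odd_partner m : odd (partner m) = ~~ odd m.
  rewrite /partner; case E: (odd m); last by rewrite /= E.
  by case: m E => //= m; case: (odd m).
have pr_lt i : (pr i < k)%N = (i < k)%N.
  case: (boolP (i < k)%N) => [lt_ik | /negbTE ge_ik].
    by have [-> ->] := prE i lt_ik.
  by rewrite /pr ge_ik.
have prK : involutive pr.
  move=> i; case: (boolP (i < k)%N) => [lt_ik | /negbTE ge_ik]; last first.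
    by rewrite /pr !ge_ik.
  have [e1 _] := prE i lt_ik; have [|e2 _] := prE (pr i); first by rewrite pr_lt.
  by apply: val_inj; rewrite /= e2 e1 partnerK.
(* For [i < k] the column is [c e_i] plus or minus [d] times its partner vector; the sign alternates
   with parity, so the two columns of a plane are orthogonal. *)
pose A (i : 'I_n) : F := if (i < k)%N then c else 1.
pose B (i : 'I_n) : F := if (i < k)%N then (-1) ^+ odd i * d else 0.
pose Q : 'M[F]_n := \matrix_(r, i) (A i * (r == i)%:R + B i * (r == pr i)%:R).
have AB i : A i * B (pr i) + B i * A (pr i) = 0.
  rewrite /A /B pr_lt; case: ifP => lt_ik; last by rewrite mulr0 mul0r addr0.
  have [-> _] := prE i lt_ik; rewrite odd_partner signrN; ring.
have colQ i : col i Q = A i *: delta_mx i 0 + B i *: delta_mx (pr i) 0.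
  by apply/colP => r; rewrite !mxE eqxx !andbT.
have dot (i j : 'I_n) : ((delta_mx i 0 : 'cV[F]_n)^T *m delta_mx j 0) 0 0 = (i == j)%:R.
  rewrite trmx_delta; have [<-|neq_ij] := eqVneq i j.
    by rewrite mul_delta_mx mxE !eqxx.
  by rewrite mul_delta_mx_0 // mxE.
exists Q; split=> [|i]; last by rewrite mxE; case: ifP; rewrite ?oner_eq0.
apply/matrixP => i j; rewrite frame_entry !colQ.
have -> : diag_mx (normal_diag n w k) i j = (if (i < k)%N then w else 1) *+ (i == j).
  by rewrite !mxE.
rewrite dot_bilinear !dot (inj_eq (inv_inj prK)).
have pr_neq : (i < k)%N -> (pr i == i) = false.
  move=> lt_ik; apply/negbTE; have [e _] := prE i lt_ik; rewrite -val_eqE /= e.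
  by apply/eqP => /(congr1 odd); rewrite odd_partner; case: odd.
have [<-|neq_ij] := eqVneq i j.
  rewrite [i == pr i]eq_sym /A /B; case: ifP => lt_ik.
    rewrite pr_neq // !mulr0 addr0 add0r !mulr1 mulrACA -signr_addb addbb mul1r.
    by rewrite wE !expr2.
  by rewrite !(mul0r, mulr0, addr0, mul1r).
rewrite !mulr0 add0r addr0 mulr0n.
have [<-|neq] := eqVneq (pr i) j; last first.
  by rewrite [i == pr j]eq_sym (inv_eq prK) [j == _]eq_sym (negPf neq) !mulr0 addr0.
by rewrite prK eqxx !mulr1 AB.
Qed.


(** * The linear map induced by an automorphism *)

Section Automorphism.
Variable a : {perm heis p n}.
Hypothesis Aa : a \in Aut P.

Let aM : {in P &, {morph a : x y / (x * y)%g}}.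
Proof. exact/morphicP/Aut_morphic. Qed.

Lemma Aut_center x : x \in skew_center p n -> a x \in skew_center p n.
Proof.
rewrite -heis_der // => P'x.
have /andP[_ /forall_inP/(_ a Aa)/subsetP] : (P^`(1) \char P)%g := der_char 1 _.
by apply; apply: imset_f.
Qed.

Definition Aut_linear (X : 'M[F]_(n, 3)) : 'M[F]_(n, 3) := (a (X, 0)).1.

Lemma pair0_P (X : 'M[F]_(n, 3)) : ((X, 0) : heis p n) \in P.
Proof. by rewrite inE trmx0 oppr0. Qed.

Lemma Aut_linearE x : x \in P -> (a x).1 = Aut_linear x.1.
Proof.
move=> Px; pose y : heis p n := (0, x.2).
have Wy : y \in skew_center p n by apply/setIdP; split=> //; move: Px; rewrite !inE.
have xE : x = (((x.1, 0) : heis p n) * y)%g.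
  by rewrite heisM /= addr0 add0r heis_form0r addr0 -surjective_pairing.
rewrite [in a x]xE aM ?pair0_P ?(subsetP (W_sub_P p n)) //.
by have /setIdP[_ /eqP ay] := Aut_center Wy; rewrite /= ay addr0.
Qed.

Lemma Aut_linearD X Y : Aut_linear (X + Y) = Aut_linear X + Aut_linear Y.
Proof.
have := aM (pair0_P X) (pair0_P Y) => /(congr1 fst) /= <-.
by rewrite Aut_linearE // groupM ?pair0_P.
Qed.

Lemma Aut_form X Y :
  a (0, b X Y *+ 2) = (0, b (Aut_linear X) (Aut_linear Y) *+ 2).
Proof.
have aR x y : x \in P -> y \in P -> a [~ x, y]%g = [~ a x, a y]%g.
  by move=> Px Py; have := @morphR _ _ _ (Morphism aM) x y Px Py.
by have := aR _ _ (pair0_P X) (pair0_P Y); rewrite !heisR.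
Qed.

End Automorphism.

Lemma Aut_linear_eq0 a X : a \in Aut P -> Aut_linear a X = 0 -> X = 0.
Proof.
move=> Aa X0.
have Wa : a (X, 0) \in skew_center p n.
  by apply/setIdP; split; [rewrite Aut_closed ?pair0_P | apply/eqP].
have : (a^-1)%g (a (X, 0)) \in skew_center p n by apply: Aut_center; rewrite ?groupV.
by rewrite permK => /setIdP[_ /eqP].
Qed.

(** Contracting with [y^T] and dividing by the norm of [y] recovers the [F^3] factor of the image,
    which is additive in [u] and so given by a matrix. *)
Lemma line_matrix a (x y : 'cV[F]_n) : a \in Aut P -> (y^T *m y) 0 0 != 0 ->
  [set a z | z in line x] = line y ->
  exists M : 'M[F]_3, forall u, Aut_linear a (x *m u) = y *m (u *m M).
Proof.
move=> Aa y0 axy; set c := (y^T *m y) 0 0 in y0.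
pose f u := c^-1 *: (y^T *m Aut_linear a (x *m u)).
have fD : {morph f : u v / u + v}.
  by move=> u v; rewrite /f mulmxDr Aut_linearD // mulmxDr scalerDr.
exists (\matrix_i f (delta_mx 0 i)) => u; rewrite -additive_mulmx // /f.
have : a (x *m u, 0) \in line y by rewrite -axy imset_f ?mem_line.
case/lineP=> _ [v]; rewrite /Aut_linear => ->.
rewrite [y^T *m _]mulmxA [y^T *m y]mx11_scalar mul_scalar_mx scalerA.
by rewrite mulVf // scale1r.
Qed.

Lemma mulr2n_inj (S T : 'M[F]_3) : S *+ 2 = T *+ 2 -> S = T.
Proof. by rewrite -!scaler_nat => /(scalerI (two_neq0 p_pr p_odd)). Qed.

(* On the line of each frame vector, [a] acts through a 3 x 3 matrix; the action on
   the center makes any two of these differ by a similitude of the wedge product,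
   whose factor is a square.  So the ratio of norms has the same square class for
   all frame vectors. *)
Lemma normal_invariant (Q R : 'M[F]_n) k l a : odd n ->
  (k <= n)%N -> (l <= n)%N ->
  orthogonal_frame Q (normal_diag n w k) -> orthogonal_frame R (normal_diag n w l) ->
  a \in Aut P -> frame_decomp R = decomp_act a (frame_decomp Q) -> k = l.
Proof.
move=> odd_n le_kn le_ln frameQ frameR Aa act_a.
have imQ i : exists j, [set a z | z in line (col i Q)] = line (col j R).
  have : [set a z | z in line (col i Q)] \in frame_decomp R.
    by rewrite act_a; apply: imset_f; apply: imset_f.
  by case/imsetP=> j _ ->; exists j.
have [s sE] := fin_all_exists imQ.
have s_inj : injective s.
  move=> i j eq_s; apply: (frame_line_inj frameQ).
  by move: (sE i); rewrite eq_s -(sE j) => /(imset_inj (@perm_inj _ a)).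
have [M ME] := fin_all_exists (fun i =>
  line_matrix Aa (frame_norm frameR (s i)) (sE i)).
pose ka i : F := normal_diag n w k 0 i; pose lb i : F := normal_diag n w l 0 (s i).
have ka0 i : ka i != 0 by have [_] := frameQ; apply.
have lb0 i : lb i != 0 by have [_] := frameR; apply.
(* The argument [(ka i)^-1 *: u] cancels the norm of [col i Q], leaving a plain wedge whose image
   under [a] is the same for all [i]. *)
have a_wedge i u v : a (0, wedge u v *+ 2) =
    (0, (lb i / ka i) *: wedge (u *m M i) (v *m M i) *+ 2).
  have := Aut_form Aa (col i Q *m ((ka i)^-1 *: u)) (col i Q *m v).
  rewrite !ME !line_coef (frame_dot frameQ) (frame_dot frameR) !eqxx !mulr1n.
  rewrite -scalemxAl !wedgeZl !scalerA divff // scale1r => ->.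
  by rewrite -/(ka i) -/(lb i).
pose c i := lb i / ka i.
have c0 i : c i != 0 by rewrite mulf_neq0 ?invr_neq0.
have c_sqE i : is_square (c i) = ((i < k) == (s i < l))%N.
  rewrite /c /ka /lb !mxE; case: (i < k)%N; case: (s i < l)%N.
  - by rewrite divff //; apply/is_squareP; exists 1; rewrite expr1n.
  - rewrite div1r; apply: negbTE; apply: contra nsq_w => /is_squareV.
    by rewrite invrK.
  - by rewrite divr1; apply: negbTE.
  - by rewrite divr1; apply/is_squareP; exists 1; rewrite expr1n.
have {}a_wedge i u v : a (0, wedge u v *+ 2) =
    (0, c i *: wedge (u *m M i) (v *m M i) *+ 2) by exact: a_wedge.
clearbody c.
have wedge_eq i j u v : c i *: wedge (u *m M i) (v *m M i) =
    c j *: wedge (u *m M j) (v *m M j).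
  have eq2 := congr1 snd (etrans (esym (a_wedge i u v)) (a_wedge j u v)).
  exact: mulr2n_inj eq2.
have M_unit i : M i \in unitmx.
  rewrite -row_free_unit; apply: inj_row_free => u uM.
  have := ME i u; rewrite uM mulmx0 => /(Aut_linear_eq0 Aa)/eqP.
  by rewrite mulcol_eq0 ?(frame_norm frameQ) // => /eqP.
have c_sq i j : is_square (c i / c j).
  have cij0 : c i / c j != 0 by rewrite mulf_neq0 ?invr_neq0.
  (* Equating the two expressions for the action on the center makes [invmx (M i) *m M j] a
     similitude with factor [c i / c j]. *)
  have [|e eE] := @wedge_similitude _ (invmx (M i) *m M j) (c i / c j) cij0.
    move=> u v.
    have := wedge_eq i j (u *m invmx (M i)) (v *m invmx (M i)).
    rewrite !(mulmxKV (M_unit i)) !mulmxA => eq_ij.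
    by rewrite mulrC -scalerA eq_ij scalerA mulVf ?scale1r.
  by apply/is_squareP; exists e.
have card_s (A : pred 'I_n) : #|[set i | A (s i)]| = #|[set i | A i]|.
  rewrite -(card_imset _ s_inj); apply: eq_card => j; rewrite !inE.
  have [s' sK s'K] := injF_bij s_inj.
  apply/imsetP/idP => [[i] | Aj]; first by rewrite inE => Ai ->.
  by exists (s' j); rewrite ?inE s'K.
have even_k := normal_even le_kn frameQ; have even_l := normal_even le_ln frameR.
pose i0 := Ordinal n_gt0.
have same i : is_square (c i) = is_square (c i0).
  apply/idP/idP => sq_i.
    by rewrite -[c i0](divfK (c0 i)) is_squareM.
  by rewrite -[c i](divfK (c0 i0)) is_squareM.
(* If the common class is trivial, [s] matches nonsquare norms with nonsquare norms and [k = l].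
   Otherwise it exchanges the classes, so [k + l = n], impossible for even [k], [l] and odd [n]. *)
case: (boolP (is_square (c i0))) => sq0.
  rewrite -(card_ord_lt le_kn) -(card_ord_lt le_ln) -(card_s (fun j => j < l)%N).
  apply: eq_card => i; rewrite !inE.
  by have := c_sqE i; rewrite same sq0 => /esym/eqP.
have kl : (k + l = n)%N.
  have := cardsC [set i : 'I_n | (i < k)%N]; rewrite card_ord card_ord_lt // => <-.
  congr (_ + _)%N; rewrite -(card_ord_lt le_ln) -(card_s (fun j => j < l)%N).
  apply: eq_card => i; rewrite !inE; have := c_sqE i; rewrite same (negPf sq0).
  by case: (i < k)%N; case: (s i < l)%N.
by move: odd_n; rewrite -kl oddD (negPf even_k) (negPf even_l).
Qed.

End Orbits.

(** The even [k] up to [n = 2 N - 1] are the [N] numbers [2 j] with [j < N], and each is realized by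
    exactly one orbit. *)
Lemma card_fr_orbits (p N : nat) : prime p -> odd p -> 0 < N ->
  #|fr_orbits (skew_pairs_groupType p (N.*2).-1)| = N.
Proof.
move=> p_pr p_odd N_gt0; set n := (N.*2).-1.
have nE : n.+1 = N.*2 by rewrite prednK // double_gt0.
have odd_n : odd n by have := congr1 odd nE; rewrite odd_double /=; case: odd.
have n_gt0 : 0 < n by case: (n) odd_n.
have [c [d nsq]] := nonsquare_sum p_pr p_odd.
have [w wE nsq_w] : exists2 w : 'F_p, (w = c ^+ 2 + d ^+ 2)%R & ~~ is_square w.
  by exists (c ^+ 2 + d ^+ 2)%R.
have le_jn (j : 'I_N) : j.*2 <= n by rewrite -ltnS nE ltn_double.
have /fin_all_exists[Q QP] (j : 'I_N) :
    exists Q : 'M['F_p]_n, orthogonal_frame Q (normal_diag n w j.*2).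
  have le := le_jn j; have ev : ~~ odd j.*2 by rewrite odd_double.
  exact: (normal_frame_exists nsq_w le ev wE).
pose P := skew_pairs_groupType p n.
pose O (Hs : {set {set heis p n}}) := [set decomp_act a Hs | a in Aut P].
have O_inj : injective (fun j => O (frame_decomp (Q j))).
  move=> i j /eqP/decomp_orbit_eqP[a Aa act_a].
  have := normal_invariant p_pr p_odd n_gt0 nsq_w odd_n (le_jn i) (le_jn j)
    (QP i) (QP j) Aa act_a.
  by move/double_inj/val_inj.
rewrite -[RHS](card_ord N) -(card_imset _ O_inj) /fr_orbits -/P.
apply: eq_card => X; apply/imsetP/imsetP => [[Hs] | [j _ ->]].
  rewrite inE => /(fully_refined_normal p_pr p_odd n_gt0 nsq_w).
  case=> k [R [le_kn frameR ->]] ->.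
  have even_k := normal_even nsq_w le_kn frameR.
  have kE : k = k./2.*2 by rewrite -[LHS]odd_double_half (negPf even_k).
  have lt_kN : k./2 < N by rewrite -ltn_double -kE -nE ltnS.
  exists (Ordinal lt_kN); first by [].
  apply/eqP/decomp_orbit_eqP.
  apply: (isometry_orbit frameR).
  by have := QP (Ordinal lt_kN); rewrite /= -kE.
exists (frame_decomp (Q j)); last by [].
by rewrite inE; apply: (frame_fully_refined p_pr p_odd n_gt0 (QP j)).
Qed.

Unset Implicit Arguments. Set Strict Implicit.

Theorem theorem1p1 (p : nat) (p_pr : prime p) (p_odd : odd p) :
  (forall (gT : finGroupType) (P : {group gT}),
     p.-group P -> nil_class P = 2 -> exponent P = p ->
     forall Hs Ks : {set {set gT}},
       fully_refined P Hs -> fully_refined P Ks ->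
       [/\ #|Hs| = #|Ks|,
           perm_eq [seq #|H| | H : {set gT} <- enum Hs] [seq #|K| | K : {set gT} <- enum Ks] &
           perm_eq [seq #|'Z(H)| | H : {set gT} <- enum Hs] [seq #|'Z(K)| | K : {set gT} <- enum Ks]])
  /\
  (forall N : nat, 0 < N ->
     exists (gT : finGroupType) (P : {group gT}),
       [/\ p.-group P, nil_class P = 2, exponent P = p &
           #|fr_orbits P| = N]).
Proof.
split=> [gT P pP class2 expP Hs Ks frHs frKs | N N_gt0].
  apply: (fr_unique p_pr p_odd pP) => //.
  - by rewrite -nil_class0 class2.
  - by move=> x Px; rewrite -expP expg_exponent.
  - by rewrite -nil_class2 class2.
exists (heis p (N.*2).-1), (skew_pairs_groupType p (N.*2).-1).
have n_gt0 : 0 < (N.*2).-1 by case: N N_gt0.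
split; last exact: card_fr_orbits.
- exact: heis_pgroup.
- exact: heis_nil_class.
- exact: heis_exponent.
Qed.
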